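(* Let $X$ be a real Banach space, $\partial$ a subdifferential on $X$ (in the sense defined in the context), and $\Omega\subset X$ a nonempty open convex subset. Let $f,g:X\to\,]-\infty,+\infty]$ be proper lower semicontinuous functions with $\Omega\cap\operatorname{dom} f\neq\emptyset$. Assume that for every $\bar x\in\Omega\cap\operatorname{dom}\partial f\cap\operatorname{dom}\partial g$ and every $u\in X$, $u\ne0$, with $\bar x+u\in\Omega\cap\operatorname{dom} f\cap\operatorname{dom} g$, the points $\bar x_t:=\bar x+tu$ satisfy the following properties: (1) $t\mapsto f(\bar x_t)$ and $t\mapsto g(\bar x_t)$ are (finite and) continuous on $[0,1]$; (2) there is a countable subset $C\subset[0,1]$ such that for every $t\in[0,1]\setminus C$, either $f^r_+(\bar x_t;u)$ or $g^r(\bar x_t;u)$ is finite, and $g$ is upper semismooth at $\bar x_t$ in the direction $u$. Then: if $\partial f(x)\subset\partial g(x)$ for all $x\in\Omega\cap\operatorname{dom} f$, there is a real constant $c$ such that $f=g+c$ on $\Omega\cap\operatorname{dom} f$.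
   Context: $X$ is a real Banach space, $X^*$ its topological dual, $\langle\cdot,\cdot\rangle$ the duality pairing. For $f:X\to\,]-\infty,+\infty]$, $\operatorname{dom} f=\{x: f(x)<+\infty\}$; $f$ is proper if $\operatorname{dom} f\ne\emptyset$; lsc means lower semicontinuous. Subderivatives: for lsc $f$, $x\in\operatorname{dom} f$, $u\in X$, $$f^r(x;u)=\liminf_{t\searrow0}\frac{f(x+tu)-f(x)}{t},\qquad f^r_+(x;u)=\limsup_{t\searrow0}\frac{f(x+tu)-f(x)}{t},$$ $$f^\uparrow(x;u)=\sup_{\delta>0}\ \limsup_{t\searrow 0,\ (y,f(y))\to(x,f(x))}\ \inf_{u'\in B_\delta(u)}\frac{f(y+tu')-f(y)}{t},$$ with values in $[-\infty,+\infty]$, where $B_\delta(u)$ is the ball of center $u$ and radius $\delta$. Subdifferentials: for $x\in\operatorname{dom} f$ let $\partial_{MR}f(x)=\{x^*\in X^*:\langle x^*,y-x\rangle+f(x)\le f(y)\ \forall y\in X\}$ and $\partial_C f(x)=\{x^*\in X^*:\langle x^*,v\rangle\le f^\uparrow(x;v)\ \forall v\in X\}$; all subdifferentials are empty at points outside $\operatorname{dom} f$. A subdifferential on $X$ is any operator $\partial$ that associates to each proper lsc $f:X\to\,]-\infty,+\infty]$ a set-valued mapping $\partial f:X\rightrightarrows X^*$ (identified with its graph in $X\times X^*$) such that $\partial_{MR}f(x)\subset\partial f(x)\subset\partial_Cf(x)$ for all $x$ and the following Separation Principle holds: for any lsc $f,\varphi$ with $\varphi$ convex Lipschitz near $\bar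 x\in\operatorname{dom} f$, if $f+\varphi$ has a local minimum at $\bar x$, then $0\in\widehat\partial f(\bar x)+\partial\varphi(\bar x)$, where $\widehat\partial f(\bar x)$ is the set of $\bar x^*\in X^*$ for which there is a net $((x_\nu,x_\nu^* ))_\nu\subset\partial f$ with $(x_\nu,f(x_\nu))\to(\bar x,f(\bar x))$, $x_\nu^*\to\bar x^*$ in the weak-star topology, and $\limsup_\nu\langle x^*_\nu,x_\nu-\bar x\rangle\le0$. Write $\operatorname{dom}\partial f=\{x:\partial f(x)\neq\emptyset\}$. Directional convergence: $x_n\to_v\bar x$ means there are $t_n>0$, $t_n\to0$, and $v_n\to v$ with $x_n=\bar x+t_nv_n$ for all $n$. $\limsup_{x\to_v\bar x}F(x)$, for $F$ defined on $\operatorname{dom} g$, is the supremum of $\limsup_nF(x_n)$ over all sequences $x_n\to_v\bar x$ in $\operatorname{dom} g$ ($-\infty$ if there are none). A lsc function $g$ is upper semismooth at $\bar x\in\operatorname{dom} g$ in the direction $u$ if $\inf_{\alpha\ge0}\limsup_{x\to_u\bar x}g^r(x;u+\alpha(\bar x-x))\le g^r(\bar x;u)$. *)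

(* Defs.v *)
From HB Require Import structures.
From mathcomp Require Import all_boot all_order all_algebra.
From mathcomp Require Import all_classical all_reals all_analysis.

Set Implicit Arguments.
Unset Strict Implicit.
Unset Printing Implicit Defensive.

Import Order.TTheory GRing.Theory Num.Theory.
Import numFieldNormedType.Exports.

Local Open Scope classical_set_scope.
Local Open Scope ring_scope.
Local Open Scope ereal_scope.

Record dual (R : realType) (X : normedModType R) := Dual {
  dual_fun :> {linear X -> R^o};
  dual_continuous : continuous dual_fun }.

(* Functions X -> ]-oo, +oo] are functions f : X -> \bar R such that
   ext_valued f holds. *)
Definition ext_valued (R : realType) (T : Type) (f : T -> \bar R) :=
  forall x, f x != -oo.

Definition edom (R : realType) (T : Type) (f : T -> \bar R) : set T :=
  [set x | f x < +oo].

Definition proper_fun (R : realType) (T : Type) (f : T -> \bar R) :=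
  ext_valued f /\ edom f !=set0.

Section subderivatives.
Context {R : realType} {X : normedModType R}.
Implicit Types (f : X -> \bar R) (x u v : X).

Definition diff_quot f x u (t : R) : \bar R :=
  (f (x + t *: u)%R - f x) / t%:E.

(* f^r(x; u) *)
Definition lower_subderiv f x u : \bar R :=
  limf_einf (diff_quot f x u) (0%R^'+).

(* f^r_+(x; u) *)
Definition upper_subderiv f x u : \bar R :=
  limf_esup (diff_quot f x u) (0%R^'+).

(* The filter of (y, f y) --> (x, f x). *)
Definition attentive_nbhs f x : set_system X :=
  filter_from (nbhs (x, f x)) (fun A => [set y | A (y, f y)]).

(* f^\uparrow(x; u) *)
Definition circa_subderiv f x u : \bar R :=
  ereal_sup [set
    limf_esup
      (fun ty : R * X =>
         ereal_inf [set diff_quot f ty.2 u' ty.1 | u' in ball u d])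
      (filter_prod (0%R^'+) (attentive_nbhs f x))
    | d in [set d : R | (0 < d)%R]].

Definition dir_cvg (xn : nat -> X) (xbar v : X) :=
  exists (t : nat -> R) (w : nat -> X),
    [/\ forall n, (0 < t n)%R,
        t @ \oo --> (0 : R)%R,
        w @ \oo --> v
      & forall n, xn n = (xbar + t n *: w n)%R].

(* limsup of F(x) as x -->_v xbar, for F defined on D *)
Definition dir_limsup (D : set X) (F : X -> \bar R) (xbar v : X) : \bar R :=
  ereal_sup [set limn_esup (F \o xn) |
    xn in [set xn | dir_cvg xn xbar v /\ forall n, D (xn n)]].

Definition upper_semismooth (g : X -> \bar R) (xbar u : X) :=
  ereal_inf [set
    dir_limsup (edom g)
      (fun x => lower_subderiv g x (u + a *: (xbar - x))%R) xbar u
    | a in [set a : R | (0 <= a)%R]] <= lower_subderiv g xbar u.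

End subderivatives.

Section subdifferentials.
Context {R : realType} {X : normedModType R}.
Implicit Types (f phi : X -> \bar R) (x v : X).

Definition MR_subdiff f x : set (dual X) :=
  [set p | edom f x /\ forall y, (p (y - x)%R)%:E + f x <= f y].

Definition C_subdiff f x : set (dual X) :=
  [set p | edom f x /\ forall v, (p v)%:E <= circa_subderiv f x v].

Definition dom_subdiff (df : X -> set (dual X)) : set X :=
  [set x | df x !=set0].

Definition directed_rel (I : Type) (le : I -> I -> Prop) :=
  [/\ inhabited I,
      forall i, le i i,
      forall i j k, le i j -> le j k -> le i k
    & forall i j, exists k, le i k /\ le j k].

Definition net_filter (I : Type) (le : I -> I -> Prop) : set_system I :=
  filter_from setT (fun i => [set j | le i j]).

(* \hat\partial f(xbar), given the mapping df = \partial f; {ptws, _ --> _} is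
   weak-star convergence, and the limsup of a net of extended reals is the
   limsup of the identity along the image of the net filter. *)
Definition limiting_subdiff f (df : X -> set (dual X)) (xbar : X) :
    set (dual X) :=
  [set p | exists (I : Type) (le : I -> I -> Prop)
             (xs : I -> X) (ps : I -> dual X),
    let F := net_filter le in
    [/\ directed_rel le,
        forall i, df (xs i) (ps i),
        (fun i => (xs i, f (xs i))) @ F --> (xbar, f xbar),
        {ptws, (fun i => ps i : X -> R) @ F --> (p : X -> R)}
      & limf_esup (fun e : \bar R => e)
          ((fun i => (ps i (xs i - xbar)%R)%:E) @ F) <= 0]].

Definition econvex phi :=
  forall x y (t : R), (0 < t < 1)%R ->
    phi (t *: x + (1 - t) *: y)%R <= t%:E * phi x + (1 - t)%:E * phi y.

Definition lipschitz_near phi x :=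
  exists2 U : set X, nbhs x U &
    (forall y, U y -> phi y \is a fin_num) /\
    [lipschitz (fine (phi y) : R^o) | y in U].

(* The last clause says 0 \in \hat\partial f(xbar) + \partial phi(xbar). *)
Definition separation_principle (df : (X -> \bar R) -> X -> set (dual X)) :=
  forall (f phi : X -> \bar R) (xbar : X),
    ext_valued f -> lower_semicontinuous f ->
    ext_valued phi -> lower_semicontinuous phi ->
    econvex phi -> lipschitz_near phi xbar -> edom f xbar ->
    (\forall y \near xbar, f xbar + phi xbar <= f y + phi y) ->
    exists p q, [/\ limiting_subdiff f (df f) xbar p, df phi xbar q
                  & forall v, (p v + q v = 0)%R].

(* The values of df matter only at proper lower semicontinuous functions. *)
Definition subdifferential (df : (X -> \bar R) -> X -> set (dual X)) :=
  (forall f, proper_fun f -> lower_semicontinuous f -> forall x,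
     MR_subdiff f x `<=` df f x /\ df f x `<=` C_subdiff f x) /\
  separation_principle df.

End subdifferentials.

(* Main.v *)
(* By Ekeland's variational principle and the Separation Principle, f satisfies
   an approximate mean value inequality: if f(b) - f(a) > l (t - s) for
   a = x + s u and b = x + t u, then some x' near [a, b[ carries q in df f(x')
   with q(u) > l - e and q > - e on the vector from x' to a nearby point of
   [a, b[.  As f is continuous along the segment, this applies with
   0 < s_n < t_n --> 0, which makes the points x' converge to x in the direction
   u.  Since q belongs to df g(x'), hence to the Clarke subdifferential of g,
   minimizing g minus a linear function along a short segment turns q into a
   lower subderivative of g at a point close to x'.  Upper semismoothness of g
   then gives f^r_+(x; u) <= g^r(x; u) outside the countable set, where f - g
   thus has a nonpositive upper right Dini derivative, so f - g is nonincreasing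
   along segments issued from points of dom (df f).  Hence f - g is constant on
   dom (df f), and this extends to dom f by graphical density. *)
Require Import Defs.
From HB Require Import structures.
From mathcomp Require Import all_boot all_order all_algebra.
From mathcomp Require Import all_classical all_reals all_analysis.
From mathcomp Require Import ring lra.

Set Implicit Arguments.
Unset Strict Implicit.
Unset Printing Implicit Defensive.

Import Order.TTheory GRing.Theory Num.Theory.
Import numFieldNormedType.Exports.

Local Open Scope classical_set_scope.
Local Open Scope ring_scope.

(** * Dini derivatives of functions of one real variable *)

Lemma upper_dini_le0 (R : realType) (h : R -> R) (C : set R) :
  {within `[0, 1], continuous h} -> countable C ->
  (forall t : R, 0 <= t < 1 -> ~ C t ->
     forall e : R, 0 < e -> \forall s \near 0^'+, h (t + s) - h t <= e * s) ->
  h 1 <= h 0.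
Proof.
move=> ch cC hd; rewrite leNgt; apply/negP => h01.
(* With half of the total increase as slope, the tilted function [k] still increases from 0 to 1,
   while outside [C] the hypothesis gives [k (t + s) <= k t] for small [s > 0]. *)
pose e := (h 1 - h 0) / 2.
have e0 : 0 < e by rewrite divr_gt0// subr_gt0.
pose k t := h t - e * t.
have ck (t : R) : 0 <= t <= 1 -> forall d : R, 0 < d ->
    \forall s \near t, 0 <= s <= 1 -> `|k t - k s| < d.
  move=> t01 d d0; have /(_ t) cht := (subspace_continuousP _ _).1 ch.
  have {}cht : h @ within `[0, 1] (nbhs t) --> h t.
    by apply: cht; rewrite /= in_itv/=.
  have /cvgrPdist_lt/(_ _ d0) : k @ within `[0, 1] (nbhs t) --> k t.
    apply: cvgB => //; apply: cvgMr; exact: cvg_within.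
  rewrite !near_withinE; apply: filterS => s + s01.
  by apply; rewrite /= in_itv/=.
have k01 : k 0 < k 1 by rewrite /k /e; lra.
(* A level y in ]k 0, k 1[ is last attained at some t < 1; the upper right Dini
   derivative of k is nonnegative there, so t is in C.  Hence C is uncountable. *)
suff kC : `]k 0, k 1[ `<=` k @` C.
  have : lebesgue_measure (`]k 0, k 1[ : set R) = 0%E.
    apply: countable_lebesgue_measure0; apply: sub_countable (subset_card_le kC) _.
    exact: sub_countable (card_image_le _ _) _.
  rewrite lebesgue_measure_itv/= lte_fin k01 -EFinB => -[] /eqP.
  by rewrite subr_eq0 (gt_eqF k01).
move=> y /=; rewrite in_itv/= => /andP[ky0 ky1].
pose S := [set t : R | (0 <= t <= 1) /\ (k t <= y)].
have S0 : S 0 by split; [rewrite lexx ler01|exact: ltW].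
have hS : has_sup S.
  by split; [exists 0 | exists 1 => t [/andP[]]].
set t := sup S.
have t01 : 0 <= t <= 1.
  apply/andP; split; first exact: ub_le_sup hS.2 _ S0.
  by apply: sup_le_ub => [|s [/andP[]]]; first by exists 0.
have kty : k t <= y.
  rewrite leNgt; apply/negP => kt.
  have [|d /= d0 Hd] := ck t t01 (k t - y); first by rewrite subr_gt0.
  have [s [s01 ksy] ts] := sup_adherent d0 hS.
  have st : s <= t by exact: ub_le_sup hS.2 _ (conj s01 ksy).
  have := Hd s; rewrite /ball/= ger0_norm ?subr_ge0// ltrBlDl -ltrBlDr => /(_ ts s01).
  by rewrite ltr_norml => /andP[_]; lra.
have t1 : t < 1.
  rewrite lt_neqAle (andP t01).2 andbT; apply/eqP => t1.
  by move: kty; rewrite t1 leNgt ky1.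
have kgt (s : R) : t < s -> s <= 1 -> y < k s.
  move=> ts s1; rewrite ltNge; apply/negP => ksy.
  suff : s <= t by rewrite leNgt ts.
  apply: ub_le_sup hS.2 _ _; split => //; rewrite s1 andbT.
  by apply: le_trans (ltW ts); case/andP: t01.
have near1 : \forall s \near (0 : R)^'+, (t + s <= 1).
  near=> s; rewrite -lerBrDl; near: s; apply: nbhs_right_le; lra.
have kty' : k t = y.
  apply/eqP; rewrite eq_le kty/= leNgt; apply/negP => kt.
  have [|d /= d0 Hd] := ck t t01 (y - k t); first by rewrite subr_gt0.
  near (0 : R)^'+ => s.
  have s0 : 0 < s by [].
  have ts1 : t + s <= 1 by near: s.
  have := Hd (t + s); rewrite /ball/= opprD addrA subrr sub0r normrN gtr0_norm//.
  have sd : s < d by near: s; exact: nbhs_right_lt.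
  have -> : (0 <= t + s <= 1) by rewrite ts1 andbT; case/andP: t01; lra.
  move=> /(_ sd isT); have := kgt (t + s); rewrite ltrDl s0 => /(_ isT ts1).
  by rewrite ltr_norml => + /andP[+ _]; lra.
exists t => //; apply: contrapT => Ct.
have := hd t _ Ct e e0; rewrite t1 (andP t01).1 => /(_ isT) ht.
near (0 : R)^'+ => s.
have s0 : 0 < s by [].
have ts1 : t + s <= 1 by near: s.
have := kgt (t + s); rewrite ltrDl s0 -kty' /k => /(_ isT ts1).
have : (h (t + s) - h t <= e * s) by near: s.
lra.
Unshelve. all: by end_near.
Qed.

Local Open Scope ereal_scope.

(** * Upper and lower limits of extended real functions along filters *)

Section limf.
Context {R : realType} {T : choiceType} {Y : filteredType T}.
Implicit Types (h : Y -> \bar R) (F : set_system Y) (A : set Y) (l : \bar R).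

Lemma limf_esup_ltP h F l :
  limf_esup h F < l -> exists2 A, F A & forall x, A x -> h x < l.
Proof.
rewrite limf_esupE => /ereal_inf_lt[_ [A FA <-]] ltl; exists A => // x Ax.
by apply: le_lt_trans ltl; apply: ereal_sup_ubound; exists x.
Qed.

Lemma limf_esup_gtP h F l A : l < limf_esup h F -> F A ->
  exists2 x, A x & l < h x.
Proof.
rewrite limf_esupE => ltl FA.
have /ereal_sup_gt[_ [x Ax <-] lx] : l < ereal_sup (h @` A).
  by apply: lt_le_trans ltl _; apply: ereal_inf_lbound; exists A.
by exists x.
Qed.

Lemma limf_esup_le h F A l : F A -> (forall x, A x -> h x <= l) ->
  limf_esup h F <= l.
Proof.
move=> FA hl; rewrite limf_esupE; apply: (@le_trans _ _ (ereal_sup (h @` A))).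
  by apply: ereal_inf_lbound; exists A.
by apply: ge_ereal_sup => _ [x Ax <-]; exact: hl.
Qed.

Lemma limf_esup_ge h F l : (forall A, F A -> exists2 x, A x & l <= h x) ->
  l <= limf_esup h F.
Proof.
move=> hl; rewrite limf_esupE; apply: le_ereal_inf_tmp => _ [A FA <-].
have [x Ax lx] := hl _ FA.
by apply: le_trans lx _; apply: ereal_sup_ubound; exists x.
Qed.

Lemma limf_einf_gtP h F l :
  l < limf_einf h F -> exists2 A, F A & forall x, A x -> l < h x.
Proof.
rewrite /limf_einf lteNr => /limf_esup_ltP[A FA hl]; exists A => // x Ax.
by rewrite -lteN2; exact: hl.
Qed.

Lemma limf_einf_ge h F A l : F A -> (forall x, A x -> l <= h x) ->
  l <= limf_einf h F.
Proof.
move=> FA hl; rewrite /limf_einf leeNr; apply: limf_esup_le FA _ => x Ax.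
by rewrite leeN2; exact: hl.
Qed.

End limf.

(** * Lower semicontinuous functions: minima on compact sets and Ekeland's principle *)

Lemma ereal_between (R : realType) (x y : \bar R) :
  x < y -> exists2 a : R, x < a%:E & a%:E < y.
Proof.
case: x y => [x||] [y||] //= xy.
- by exists ((x + y) / 2)%R; move: xy; rewrite !lte_fin; lra.
- by exists (x + 1)%R; rewrite ?lte_fin ?ltrDl// ltry.
- by exists (y - 1)%R; rewrite ?lte_fin ?gtrBl// ltNyr.
- by exists 0%R; rewrite ?ltNyr ?ltry.
Qed.

(** Without a minimizer, every point of [A] has a neighbourhood on which [h] exceeds some earlier
    value [h t]. The sublevel sets [G] form a filter base, so compactness in its near-covering form
    makes this uniform on [A], and the contradiction is [h s < h s]. *)
Lemma lsc_min (R : realType) (T : topologicalType) (h : T -> \bar R)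
    (A : set T) : lower_semicontinuous h -> compact A -> A !=set0 ->
  exists2 c, A c & forall t, A t -> h c <= h t.
Proof.
move=> lh /compact_near_coveringP cA [a Aa]; apply: contrapT => nomin.
pose G s := [set t | A t /\ h t <= h s].
have FF : Filter (filter_from A G).
  apply: filter_from_filter; first by exists a.
  move=> s t As At; have [st|/ltW ts] := leP (h s) (h t).
    exists s => // u [Au us]; split; split => //; exact: le_trans us st.
  exists t => // u [Au us]; split; split => //; exact: le_trans us ts.
have [|s As Gs] := cA T (filter_from A G) (fun t c => h t < h c) FF.
  move=> c Ac; have [t At htc] : exists2 t, A t & h t < h c.
    apply: contrapT => hc; apply: nomin; exists c => // t At.
    by rewrite leNgt; apply/negP => htc; apply: hc; exists t.
  have [r tr rc] := ereal_between htc.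
  have [V Vc hV] := lh _ _ rc.
  exists (V, G t) => /=; first by split => //; exists t.
  by move=> [c' t'] /= [/hV rc' [_ tt']]; exact: le_lt_trans tt' (lt_trans tr rc').
have /(_ s As) := Gs s (conj As (lexx _)).
by rewrite ltxx.
Qed.

(** Local form on a closed ball, where alone [h] is bounded below. The point is the limit of a
    sequence in which each term almost minimizes [h] over the points reachable from the previous one
    by a descent of slope at least [e]. *)
Lemma ekeland (R : realType) (X : completeNormedModType R) (h : X -> \bar R)
    (x0 : X) (r e d : R) :
  lower_semicontinuous h -> h x0 \is a fin_num -> (0 < e)%R -> (0 < r)%R ->
  (forall x, (`|x - x0| <= r)%R -> h x0 <= h x + (e * d)%:E) ->
  exists x1, [/\ (`|x1 - x0| <= r)%R, (`|x1 - x0| <= d)%R,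
    h x1 + (e * `|x1 - x0|)%:E <= h x0
    & forall x, (`|x - x0| <= r)%R -> h x1 <= h x + (e * `|x - x1|)%:E].
Proof.
move=> lh hx0 e0 r0 hmin.
pose B x := (`|x - x0| <= r)%R.
pose k x := fine (h x).
pose D x := B x /\ h x \is a fin_num.
have kE x : D x -> h x = (k x)%:E by move=> [_ hx]; rewrite /k fineK.
have hNy x : B x -> h x != -oo.
  move=> Bx; apply/eqP => hx; have := hmin x Bx.
  by rewrite hx addNye leeNy_eq => /eqP h0; rewrite h0 in hx0.
have Dx0 : D x0 by split => //; rewrite /B subrr normr0 ltW.
have klb x : D x -> (k x0 - e * d <= k x)%R.
  by move=> Dx; have := hmin x Dx.1; rewrite !kE// -EFinD lee_fin lerBlDr.
(* [S x] is the set of points below [x] in Ekeland's order; transitivity makes the sets [S (x_ n)]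
   decreasing. *)
pose S x y := D y /\ (k y + e * `|y - x| <= k x)%R.
have Sxx x : D x -> S x x by move=> Dx; split => //; rewrite subrr normr0 mulr0 addr0.
have Strans y x z : S x y -> S y z -> S x z.
  move=> [Dy xy] [Dz yz]; split => //.
  have : (`|z - x| <= `|z - y| + `|y - x|)%R.
    by rewrite (le_trans _ (ler_normD _ _))// addrA subrK.
  move=> /(ler_wpM2l (ltW e0)); rewrite mulrDr; lra.
have next n x : exists y, D x -> S x y /\
    forall z, S x z -> (k y <= k z + n.+1%:R^-1)%R.
  have [Dx|nDx] := pselect (D x); last by exists x.
  have lbk : has_inf [set k z | z in S x].
    split; first by exists (k x), x => //; exact: Sxx.
    by exists (k x0 - e * d)%R => _ [z [Dz _] <-]; exact: klb.
  have n0 : (0 < n.+1%:R^-1 :> R)%R by [].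
  have [_ [y xy <-] yz] := inf_adherent n0 lbk.
  exists y => _; split => // z xz; apply: le_trans (ltW yz) _; rewrite lerD2r.
  by apply: ge_inf; [exact: lbk.2|exists z].
pose nx n x := sval (cid (next n x)).
have nxP n x : D x -> S x (nx n x) /\
    forall z, S x z -> (k (nx n x) <= k z + n.+1%:R^-1)%R.
  by rewrite /nx; case: cid => y /= H Dx; exact: H.
pose x_ := fix x_ n := if n is m.+1 then nx m (x_ m) else x0.
have Dx_ n : D (x_ n).
  by elim: n => // n IH; exact: (nxP n _ IH).1.1.
have S_ n m : (n <= m)%N -> S (x_ n) (x_ m).
  move=> /subnK <-; elim: (m - n)%N => [|p IH]; first by rewrite add0n; exact: Sxx.
  by apply: Strans IH _; rewrite addSn; exact: (nxP _ _ (Dx_ _)).1.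
(* Near-minimality of [x_ n.+1] over [S (x_ n)] bounds the descent still possible, hence the radius
   of [S (x_ n.+1)]. This makes the sequence Cauchy. *)
have Sdist n z : S (x_ n.+1) z -> (e * `|z - x_ n.+1| <= n.+1%:R^-1)%R.
  move=> Sz; have Sz' : S (x_ n) z by apply: Strans Sz; exact: S_.
  have : (k (x_ n.+1) <= k z + n.+1%:R^-1)%R by exact: (nxP n _ (Dx_ n)).2.
  have : (k z + e * `|z - x_ n.+1| <= k (x_ n.+1))%R := Sz.2.
  move: (e * _)%R (n.+1%:R^-1)%R => a b; lra.
have inv0 : harmonic @ \oo --> (0 : R)%R by exact: cvg_harmonic.
have invlt (c : R) : (0 < c)%R -> exists n : nat, (n.+1%:R^-1 < c)%R.
  move=> c0; have /cvgr0Pnorm_lt/(_ _ c0)[N _ /(_ N (leqnn _))/=] := inv0.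
  by rewrite ger0_norm//; exists N.
have /cauchy_cvg cx : cauchy (x_ @ \oo).
  apply/cauchy_exP => c c0; have [n nc] := invlt (e * c)%R (mulr_gt0 e0 c0).
  exists (x_ n.+1); exists n.+1 => // m /= nm.
  have := Sdist _ _ (S_ _ _ nm); rewrite -ball_normE/= distrC => H.
  by rewrite -(ltr_pM2l e0) (le_lt_trans H).
pose x1 := lim (x_ @ \oo).
have cx1 : x_ @ \oo --> x1 by exact: cx.
have Bx1 : B x1.
  rewrite /B; have : (fun n => `|x_ n - x0|)%R @ \oo --> (`|x1 - x0|)%R.
    by apply: cvg_norm; apply: cvgB => //; exact: cvg_cst.
  apply: (closed_cvg (fun y : R => y <= r)%R); first exact: closed_le.
  by apply: nearW => n; exact: (Dx_ n).1.
(* Lower semicontinuity passes the order inequality to the limit: a violation at [x1] would persist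
   at [x_ m] for large [m]. *)
have Sx1 n : S (x_ n) x1.
  have hx1 : h x1 + (e * `|x1 - x_ n|)%:E <= h (x_ n).
    rewrite leNgt (kE _ (Dx_ n)); apply/negP.
    rewrite -lteBlDr// -EFinB => /ereal_between[a ka ah].
    have [V Vx1 hV] := lh _ _ ah.
    have nV : \forall m \near \oo, V (x_ m) by exact: cx1.
    have : (fun m => k (x_ n) - e * `|x_ m - x_ n|)%R @ \oo -->
           (k (x_ n) - e * `|x1 - x_ n|)%R.
      apply: cvgB; first exact: cvg_cst.
      apply: cvgMr; apply: cvg_norm; apply: cvgB => //; exact: cvg_cst.
    move=> /cvgr_lt/(_ a); rewrite -lte_fin => /(_ ka) na.
    near \oo => m.
    have nm : (n <= m)%N by near: m; exists n.
    have : (k (x_ m) + e * `|x_ m - x_ n| <= k (x_ n))%R := (S_ _ _ nm).2.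
    have : (a%:E < h (x_ m)) by apply: hV; near: m.
    have : (k (x_ n) - e * `|x_ m - x_ n| < a)%R by near: m.
    rewrite (kE _ (Dx_ m)) lte_fin; move: (e * _)%R => b; lra.
  have Dx1 : D x1.
    split => //; rewrite fin_numE hNy//=; apply/eqP => hy.
    by move: hx1; rewrite hy addye// (kE _ (Dx_ n)) leye_eq.
  by split=> //; move: hx1; rewrite (kE _ Dx1) (kE _ (Dx_ n)) -EFinD lee_fin.
have Dx1 := (Sx1 0%N).1.
exists x1; split => //.
- have : (k x1 + e * `|x1 - x0| <= k x0)%R := (Sx1 0%N).2.
  move=> H; rewrite -(ler_pM2l e0).
  by move: H; have := klb _ Dx1; lra.
- by have := (Sx1 0%N).2; rewrite /= (kE _ Dx1) (kE _ Dx0) -EFinD lee_fin.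
- move=> x Bx; rewrite leNgt; apply/negP => hx.
  have Dx : D x.
    split => //; rewrite fin_numE hNy//=; apply/eqP => hy.
    by move: hx; rewrite hy addye// (kE _ Dx1).
  have kx : (k x + e * `|x - x1| < k x1)%R.
    by move: hx; rewrite (kE _ Dx) (kE _ Dx1) -EFinD lte_fin.
  have S1x : S x1 x by split=> //; exact: ltW.
  (* A point violating the last inequality lies below [x1], hence in every [S (x_ n)]; as these sets
     shrink to a point, it equals [x1], which is absurd. *)
  suff xx1 : x = x1 by move: kx; rewrite xx1 subrr normr0 mulr0 addr0 ltxx.
  apply/eqP; rewrite -subr_eq0 -normr_le0 leNgt; apply/negP => nxx1.
  have c0 : (0 < e * `|x - x1| / 2)%R by rewrite divr_gt0// mulr_gt0.
  have [n] := invlt _ c0.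
  have := Sdist n _ (Sx1 n.+1); have := Sdist n _ (Strans _ _ _ (Sx1 n.+1) S1x).
  have : (`|x - x1| <= `|x - x_ n.+1| + `|x1 - x_ n.+1|)%R.
    by rewrite (distrC x1) (le_trans _ (ler_normD _ _))// addrA subrK.
  move=> /(ler_wpM2l (ltW e0)); rewrite mulrDr.
  move: (_ * _)%R (_ * _)%R (_ * _)%R (_^-1)%R => a b c v.
  lra.
Unshelve. all: by end_near.
Qed.

Lemma lscD (R : realType) (T : topologicalType) (f : T -> \bar R)
    (phi : T -> R) : lower_semicontinuous f -> continuous phi ->
  lower_semicontinuous (fun x => f x + (phi x)%:E).
Proof.
move=> lf cphi x a; rewrite -lteBlDr// -EFinB => /ereal_between[b ab bf].
rewrite lte_fin in ab.
have [V Vx hV] := lf _ _ bf.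
have Wx : nbhs x [set y | (a - b < phi y)%R].
  have /cvgr_gt : phi @ x --> phi x := cphi x; apply; lra.
exists (V `&` [set y | (a - b < phi y)%R]); first exact: filterI.
move=> y [/hV by_ /= ya]; rewrite -lteBlDr// -EFinB.
by apply: lt_trans by_; rewrite lte_fin; lra.
Qed.

Lemma lsc_comp (R : realType) (S T : topologicalType) (h : T -> \bar R)
    (k : S -> T) :
  lower_semicontinuous h -> continuous k -> lower_semicontinuous (h \o k).
Proof.
move=> lh ck x a /lh[V Vx hV]; exists (k @^-1` V); first exact: ck.
by move=> y; exact: hV.
Qed.

(** * Convex Lipschitz functions and their Clarke subgradients *)

(** The penalties are real-valued and globally Lipschitz, so that after [EFin] they qualify for the
    Separation Principle at every point. *)
Definition convex_lip (R : realType) (X : normedModType R) (phi : X -> R) :=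
  (forall x y t, (0 < t < 1 ->
     phi (t *: x + (1 - t) *: y) <= t * phi x + (1 - t) * phi y)%R) /\
  exists L, forall x y, (`|phi x - phi y| <= L * `|x - y|)%R.

Section convex_lip.
Context {R : realType} {X : normedModType R}.
Implicit Types (f : X -> \bar R) (phi psi : X -> R).

Lemma convex_lipP phi : convex_lip phi ->
  exists2 L, (0 < L)%R & forall x y, (`|phi x - phi y| <= L * `|x - y|)%R.
Proof.
move=> [_ [L hL]]; exists (Num.max L 1)%R; first by rewrite lt_max ltr01 orbT.
by move=> x y; apply: le_trans (hL x y) _; rewrite ler_wpM2r// le_max lexx.
Qed.

Lemma convex_lip_continuous phi : convex_lip phi -> continuous phi.
Proof.
move=> /convex_lipP[L L0 hL] x; apply/cvgrPdist_lt => e e0.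
near=> y; apply: le_lt_trans (hL _ _) _.
rewrite mulrC -ltr_pdivlMr//; near: y.
by apply: (@cvgr_dist_lt _ _ _ _ _ id x) => //; rewrite divr_gt0.
Unshelve. all: by end_near. Qed.

Lemma convex_lip_norm (e : R) (z : X) : (0 <= e)%R ->
  convex_lip (fun x => e * `|x - z|)%R.
Proof.
move=> e0; split=> [x y t /andP[t0 t1]|].
  have -> : (t *: x + (1 - t) *: y - z = t *: (x - z) + (1 - t) *: (y - z))%R.
    by rewrite !scalerBr addrACA -opprD -scalerDl addrCA subrr addr0 scale1r.
  rewrite -[leRHS](_ : e * (t * `|x - z| + (1 - t) * `|y - z|) = _)%R; last ring.
  rewrite ler_wpM2l// (le_trans (ler_normD _ _))// !normrZ.
  by rewrite !ger0_norm// ?subr_ge0 ltW.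
exists e => x y; rewrite -mulrBr normrM ger0_norm// ler_wpM2l//.
by rewrite (le_trans (ler_dist_dist _ _))// opprB addrA subrK.
Qed.

Lemma convex_lipD phi psi : convex_lip phi -> convex_lip psi ->
  convex_lip (fun x => phi x + psi x)%R.
Proof.
move=> [cphi [L hL]] [cpsi [M hM]]; split=> [x y t t01|].
  by have := cphi x y t t01; have := cpsi x y t t01; lra.
exists (L + M)%R => x y; rewrite opprD addrACA (le_trans (ler_normD _ _))//.
by rewrite mulrDl lerD.
Qed.

Lemma diff_quotE f x u t : (0 < t)%R ->
  diff_quot f x u t = (f (x + t *: u)%R - f x) * (t^-1)%:E.
Proof. by move=> t0; rewrite /diff_quot inver gt_eqF. Qed.

Lemma attentive_nbhs_near f x (V : set X) : nbhs x V -> attentive_nbhs f x V.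
Proof.
move=> Vx; exists [set y | V y.1] => //=.
by exists (V, setT) => /=; [split => //; exact: filterT | move=> y []].
Qed.

(** Convexity bounds the quotient at [y] with step [t < 1] by [phi (y + v) - phi y], and the
    Lipschitz condition replaces [y] by [x] at a small cost. The inner infimum is estimated at the
    direction [v] itself. *)
Lemma C_subdiff_convex phi x q : convex_lip phi ->
  C_subdiff (EFin \o phi) x q -> forall v, (q v <= phi (x + v) - phi x)%R.
Proof.
move=> cphi [_ hq] v; rewrite -lee_fin; apply: le_trans (hq v) _.
have [L L0 hL] := convex_lipP cphi.
apply: ge_ereal_sup => _ [d /= d0 <-]; apply/lee_addgt0Pr => e e0.
(* Replacing [y] by [x] in [phi (y + v) - phi y] costs at most [2 * L] times their distance, hence
   the radius [e / (2 * L)]. *)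
pose A := [set ty : R * X | (0 < ty.1 < 1)%R /\ (`|x - ty.2| < e / (2 * L))%R].
apply: (@limf_esup_le _ _ _ _ _ A).
  exists ([set t | (0 < t < 1)%R], [set y | (`|x - y| < e / (2 * L))%R]) => //=.
  split.
    by near=> t; rewrite /=; apply/andP; split.
  apply: attentive_nbhs_near; apply: (@cvgr_dist_lt _ _ _ _ _ id x) => //.
  by rewrite divr_gt0// mulr_gt0.
move=> [t y] [/= t01 yx]; apply: ereal_inf_le.
exists (diff_quot (EFin \o phi) y v t); first by exists v => //; exact: ballxx.
have /andP[t0 t1] := t01.
rewrite diff_quotE// lee_pdivrMr// -!EFinD -EFinM lee_fin.
have -> : (y + t *: v = t *: (y + v) + (1 - t) *: y)%R.
  by rewrite scalerDr scalerBl scale1r [RHS]addrC addrA subrK.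
have := cphi.1 (y + v)%R y t t01.
have : (phi (y + v) - phi y <= phi (x + v) - phi x + e)%R.
  have := hL x y; have := hL (x + v)%R (y + v)%R.
  rewrite [(- (y + v))%R]opprD addrACA subrr addr0 !ler_norml.
  move: yx; rewrite ltr_pdivlMr ?mulr_gt0//; nra.
move=> /(ler_wpM2l (ltW t0)); lra.
Unshelve. all: by end_near. Qed.

End convex_lip.

(** * Extracting one subgradient from a limiting net *)

Lemma net_filter_proper (I : Type) (le : I -> I -> Prop) :
  directed_rel le -> ProperFilter (net_filter le).
Proof.
move=> [[i0] lexx_ letr led]; apply: filter_from_proper.
  apply: filter_from_filter; first by exists i0.
  move=> i j _ _; have [k [ik jk]] := led i j.
  by exists k => // l /= kl; split; [exact: letr ik kl|exact: letr jk kl].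
by move=> i _; exists i; exact: lexx_.
Qed.

Lemma nbhs_fin_num_dist (R : realType) (y : \bar R) (e : R) :
  y \is a fin_num -> (0 < e)%R ->
  nbhs y [set z | z \is a fin_num /\ (`|fine z - fine y| < e)%R].
Proof.
case: y => // r _ e0.
apply: (@filterS _ (nbhs r%:E) _ (EFin @` ball r e)).
  by move=> _ [s rs <-] /=; split=> //; rewrite distrC.
by apply: nbhs_image_EFin; exact: nbhsx_ballx.
Qed.

Section limiting.
Context {R : realType} {X : normedModType R}.
Implicit Types (f : X -> \bar R) (D : X -> set (dual X)).

(** Weak-star convergence controls only finitely many directions at one index of the net; two
    directions are enough for the mean value inequality. *)
Lemma limiting_subdiff_approx f D x p (e : R) (v w : X) :
  limiting_subdiff f D x p -> f x \is a fin_num -> (0 < e)%R ->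
  exists y q, [/\ D y q,
    (`|y - x| < e)%R /\ f y \is a fin_num /\ (`|fine (f y) - fine (f x)| < e)%R,
    (`|q v - p v| < e)%R, (`|q w - p w| < e)%R & (q (y - x) < e)%R].
Proof.
move=> [I [le [xs [ps [dle Dxs cxs cps ls]]]]] fx e0.
have PF := net_filter_proper dle.
pose F := net_filter le.
have near1 : \forall i \near F, (`|xs i - x| < e)%R /\
    (f (xs i) \is a fin_num /\ (`|fine (f (xs i)) - fine (f x)| < e)%R).
  apply: (cxs [set yz : X * \bar R | (`|yz.1 - x| < e)%R /\
    (yz.2 \is a fin_num /\ (`|fine yz.2 - fine (f x)| < e)%R)]).
  exists ([set y | (`|y - x| < e)%R],
          [set z | z \is a fin_num /\ (`|fine z - fine (f x)| < e)%R]) => /=.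
    split; last exact: nbhs_fin_num_dist.
    by apply: filterS (nbhsx_ballx x e e0) => y; rewrite -ball_normE/= distrC.
  by move=> [y z] [].
have near2 z : \forall i \near F, (`|ps i z - p z| < e)%R.
  have [/(_ cps z) + _] := @pointwise_cvgP X R (ps @ F) p _.
  move=> /cvgrPdist_lt/(_ _ e0).
  move=> H; apply: (@filterS _ F _ _ _ _ H) => i /=; first by rewrite distrC.
have [A FA hA] : exists2 A, ((fun i => (ps i (xs i - x)%R)%:E) @ F) A &
    forall z, A z -> z < e%:E.
  by apply: limf_esup_ltP; apply: le_lt_trans ls _; rewrite lte_fin.
have near3 : \forall i \near F, (ps i (xs i - x) < e)%R.
  by apply: (@filterS _ F _ _ _ _ FA) => i /= /hA; rewrite lte_fin.
near F => i; exists (xs i), (ps i); split=> //.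
- by near: i.
- by near: i; exact: near2.
- by near: i; exact: near2.
- by near: i; exact: near3.
Unshelve. all: by end_near. Qed.

End limiting.

(** * Separation Principle combined with Ekeland's principle *)

Section separation.
Context {R : realType} {X : completeNormedModType R}.
Context (df : (X -> \bar R) -> X -> set (dual X)) (sdf : subdifferential df).
Implicit Types (f : X -> \bar R) (phi : X -> R).

(** Ekeland's principle turns the approximate minimizer [x0] of [f + phi] into a local minimizer
    [x1] of [f + psi], where [psi] adds a cone of slope [e]. The Separation Principle gives [p]
    opposite to a subgradient of [psi] at [x1], and the last inequality is the convex subgradient
    inequality for [psi]. *)
Lemma separation_ekeland f phi (x0 : X) (r e d : R) :
  ext_valued f -> lower_semicontinuous f -> convex_lip phi ->
  f x0 \is a fin_num -> (0 < e)%R -> (0 < r)%R -> (d < r)%R ->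
  (forall x, (`|x - x0| <= r)%R ->
     f x0 + (phi x0)%:E <= f x + (phi x)%:E + (e * d)%:E) ->
  exists x1 p, [/\ (`|x1 - x0| <= d)%R,
    f x1 + (phi x1)%:E <= f x0 + (phi x0)%:E,
    limiting_subdiff f (df f) x1 p
    & forall v, (phi x1 - phi (x1 + v) - e * `|v| <= p v)%R].
Proof.
move=> vf lf cphi fx0 e0 r0 dr hmin.
have lh := lscD lf (convex_lip_continuous cphi).
have [] := ekeland lh _ e0 r0 hmin; first by rewrite fin_numD fx0.
move=> x1 [x1r x1d hx1 mx1].
have hx1' : f x1 + (phi x1)%:E <= f x0 + (phi x0)%:E.
  by apply: le_trans hx1; rewrite leeDl// lee_fin mulr_ge0// ltW.
pose psi x := (phi x + e * `|x - x1|)%R.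
have cpsi : convex_lip psi by apply: convex_lipD => //; exact/convex_lip_norm/ltW.
have edx1 : edom f x1.
  rewrite /edom /= ltey; apply/eqP => fy; move: hx1'.
  by rewrite fy addye// leye_eq -(fineK fx0).
have vpsi : ext_valued (EFin \o psi) by [].
have lpsi : lower_semicontinuous (EFin \o psi).
  have -> : EFin \o psi = (fun x => 0 + (psi x)%:E).
    by apply/funext => x; rewrite add0e.
  apply: lscD; last exact: convex_lip_continuous.
  by move=> x a a0; exists setT => //; exact: filterT.
have epsi : econvex (EFin \o psi).
  by move=> x y t t01; rewrite /= -!EFinM -EFinD lee_fin; exact: cpsi.1.
have lippsi : lipschitz_near (EFin \o psi) x1.
  exists setT; first exact: filterT.
  split=> //; have [_ [L hL]] := cpsi.
  have PF : ProperFilter (globally ([set: X] `*` [set: X])).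
    exact: (@globally_properfilter _ _ (x1, x1)).
  apply: (@klipschitzW _ _ _ L) => -[x y] _ /=; exact: hL.
have locmin : \forall y \near x1, f x1 + (EFin \o psi) x1 <= f y + (EFin \o psi) y.
  near=> y; rewrite /psi /= subrr normr0 mulr0 addr0 EFinD addeA.
  apply: mx1.
  (* Since [d < r], points this close to [x1] stay in the ball on which Ekeland's inequality
     holds. *)
  have : (`|x1 - y| < r - d)%R.
    near: y; apply: (@cvgr_dist_lt _ _ _ _ _ id x1) => //; lra.
  have : (`|y - x0| <= `|x1 - y| + `|x1 - x0|)%R.
    by rewrite (distrC x1) (le_trans _ (ler_normD _ _))// addrA subrK.
  by have := x1d; lra.
have [p [q [hp hq pq]]] := sdf.2 _ _ _ vf lf vpsi lpsi epsi lippsi edx1 locmin.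
exists x1, p; split=> // v.
have pr : proper_fun (EFin \o psi) by split=> //; exists x1; rewrite /edom/= ltry.
have := C_subdiff_convex cpsi ((sdf.1 _ pr lpsi x1).2 q hq) v.
rewrite /psi subrr normr0 mulr0 addr0 (addrC x1) addrK (addrC v).
have := pq v; lra.
Unshelve. all: by end_near. Qed.

(** Graphical density: by lower semicontinuity every point of the domain almost minimizes [f] on a
    small ball, so the separation result applies with zero penalty. *)
Lemma dom_subdiff_dense f (x0 : X) (e : R) :
  ext_valued f -> lower_semicontinuous f -> f x0 \is a fin_num -> (0 < e)%R ->
  exists y, [/\ dom_subdiff (df f) y, (`|y - x0| < e)%R, f y \is a fin_num
    & (`|fine (f y) - fine (f x0)| < e)%R].
Proof.
move=> vf lf fx0 e0.
have e20 : (0 < e / 2)%R by rewrite divr_gt0.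
have [|V /nbhs_ballP[s /= s0 hs] hV] := lf x0 (fine (f x0) - e / 2)%R.
  by rewrite -[ltRHS]fineK// lte_fin; lra.
pose r := (Num.min (e / 2) (s / 2))%R.
have r0 : (0 < r)%R by rewrite lt_min e20 divr_gt0.
have lb x : (`|x - x0| <= r)%R -> (fine (f x0) - e / 2)%:E < f x.
  move=> xr; apply: hV; apply: hs; rewrite -ball_normE/= distrC.
  apply: le_lt_trans xr _; rewrite /r gt_min; apply/orP; right; lra.
have r20 : (0 < r / 2)%R by rewrite divr_gt0.
have c0 : convex_lip (fun _ : X => 0%R : R).
  split=> [x y t _|]; first by rewrite !mulr0 addr0.
  by exists 0%R => x y; rewrite subrr normr0 mul0r.
(* The slope [e / r] and the distance [r / 2] multiply to [e / 2], the gap allowed by lower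
   semicontinuity; the other [e / 2] is left for passing from [x1] to a nearby point of the net. *)
have [|||x1 [p [x1d fx1 hp _]]] :=
    @separation_ekeland f _ x0 r (e / r)%R (r / 2)%R vf lf c0 fx0 _ r0.
- by rewrite divr_gt0.
- lra.
- move=> x xr; have := lb x xr; rewrite !adde0 => H.
  have -> : (e / r * (r / 2) = e / 2)%R by field; lra.
  by rewrite -leeBlDr// ltW// -(fineK fx0) -EFinB.
move: fx1; rewrite !adde0 => fx1.
have x1r : (`|x1 - x0| <= r)%R by apply: le_trans x1d _; lra.
have lbx1 := lb _ x1r.
have ffx1 : f x1 \is a fin_num.
  rewrite fin_real// (lt_le_trans _ (ltW lbx1)) ?ltNyr//=.
  by rewrite (le_lt_trans fx1)// ltey_eq fx0.
have [y [q [dy [yx [fy fyx]] _ _ _]]] := limiting_subdiff_approx x0 x0 hp ffx1 e20.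
exists y; split => //; first by exists q.
  have : (r <= e / 2)%R by rewrite /r ge_min lexx.
  have : (`|y - x0| <= `|y - x1| + `|x1 - x0|)%R.
    by rewrite (le_trans _ (ler_normD _ _))// addrA subrK.
  move: yx x1d; lra.
move: lbx1 fx1; rewrite -(fineK ffx1) -(fineK fx0) lte_fin lee_fin /=.
move: fyx; rewrite !ltr_norml; lra.
Qed.

End separation.

Section dual_linear.
Context {R : realType} {X : normedModType R}.
Implicit Types (q : dual X) (x y : X).

Lemma dualB q x y : q (x - y)%R = (q x - q y)%R.
Proof. exact: linearB. Qed.

Lemma dualD q x y : q (x + y)%R = (q x + q y)%R.
Proof. exact: linearD. Qed.

Lemma dualZ q (a : R) x : q (a *: x)%R = (a * q x)%R.
Proof. exact: linearZ. Qed.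

End dual_linear.

(** * Penalization along a segment *)

Section segment.
Context {R : realType} {X : normedModType R}.
Implicit Types (f : X -> \bar R) (x u : X).

Lemma line_continuous x u : continuous (fun t : R => x + t *: u)%R.
Proof.
by move=> t; apply: cvgD; [exact: cvg_cst|apply: cvgZr_tmp; exact: cvg_id].
Qed.

(* The infimal convolution of [K |.|] with the affine function
   [x + t u |-> - l t] on the segment; it replaces the continuous linear form
   taking the value [- l] at [u] that Hahn-Banach would provide. *)
Lemma segment_penalty x u (s t l K : R) : (s <= t)%R -> (0 <= K)%R ->
  exists phi : X -> R, [/\ convex_lip phi,
    forall y a, (s <= a <= t -> phi y <= K * `|y - (x + a *: u)| - l * a)%R
    & forall y, exists2 a,
        (s <= a <= t)%R & (phi y = K * `|y - (x + a *: u)| - l * a)%R].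
Proof.
move=> st K0; pose h y a := (K * `|y - (x + a *: u)| - l * a)%R.
have amin y : exists a, (s <= a <= t)%R /\
    forall b, (s <= b <= t)%R -> (h y a <= h y b)%R.
  have ch : {within `[s, t], continuous (h y)}.
    apply: continuous_subspaceT => a; apply: cvgB.
      apply: cvgMr; apply: cvg_norm; apply: cvgB; first exact: cvg_cst.
      exact: line_continuous.
    by apply: cvgMr; exact: cvg_id.
  have [a ast amin] := EVT_min st ch.
  exists a; split=> [|b bst]; first by rewrite in_itv/= in ast.
  by apply: amin; rewrite in_itv.
pose c y := sval (cid (amin y)).
have cst y : (s <= c y <= t)%R by rewrite /c; case: cid => a [].
have cmin y b : (s <= b <= t)%R -> (h y (c y) <= h y b)%R.
  by move=> bst; rewrite /c; case: cid => /= a [_]; exact.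
exists (fun y => h y (c y)); split; [split| |] => //.
- move=> y z b b01; have /andP[b0 b1] := b01.
  (* [h] is jointly convex in the point and the parameter, so the convex combination of the two
     minimizing parameters is a suitable competitor. *)
  pose a := (b * c y + (1 - b) * c z)%R.
  have ast : (s <= a <= t)%R.
    have /andP[? ?] := cst y; have /andP[? ?] := cst z.
    by apply/andP; split; rewrite /a; nra.
  apply: le_trans (cmin _ _ ast) _; rewrite /h.
  have -> : (b *: y + (1 - b) *: z - (x + a *: u) =
      b *: (y - (x + c y *: u)) + (1 - b) *: (z - (x + c z *: u)))%R.
    rewrite /a !scalerBr !scalerDr scalerDl !scalerA addrACA -!opprD; congr (_ - _)%R.
    by rewrite addrACA -!scalerDl (addrC b (1 - b)%R) subrK scale1r.
  have := ler_normD (b *: (y - (x + c y *: u)))%R ((1 - b) *: (z - (x + c z *: u)))%R.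
  rewrite !normrZ gtr0_norm// gtr0_norm ?subr_gt0//.
  by move=> /(ler_wpM2l K0); rewrite /a; lra.
- exists K => y z; have H y' z' : (h y' (c y') - h z' (c z') <= K * `|y' - z'|)%R.
    have := cmin y' _ (cst z'); rewrite /h.
    have : (`|y' - (x + c z' *: u)| <= `|y' - z'| + `|z' - (x + c z' *: u)|)%R.
      by rewrite (le_trans _ (ler_normD _ _))// addrA subrK.
    by move=> /(ler_wpM2l K0); lra.
  rewrite ler_norml H andbT; have := H z y; rewrite distrC; lra.
- by move=> y; exists (c y).
Qed.

End segment.

Lemma lee_addr_gt (R : realDomainType) (y : \bar R) (a b c : R) :
  a%:E < y -> (c <= a + b)%R -> c%:E <= y + b%:E.
Proof.
move=> ay cab; rewrite -leeBlDr// -EFinB; apply: le_trans (ltW ay).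
by rewrite lee_fin lerBlDr.
Qed.

(** Close to the segment, lower semicontinuity keeps [f] above the affine bound up to [e]; away from
    it, [K] times the distance outweighs the lower bound [M]. Compactness of the parameter interval
    gives one [K] for all parameters. *)
Lemma penalized_segment_min (R : realType) (X : normedModType R)
    (f : X -> \bar R) (xb u : X) (s t l m M e r : R) (x0 : X) :
  lower_semicontinuous f -> (0 < e)%R ->
  (forall a, (s <= a <= t)%R -> (m + l * a)%:E <= f (xb + a *: u)%R) ->
  (forall x, (`|x - x0| <= r)%R -> M%:E < f x) ->
  exists2 K, (0 <= K)%R &
    forall x a, (`|x - x0| <= r)%R -> (s <= a <= t)%R ->
      (m - e)%:E <= f x + (K * `|x - (xb + a *: u)| - l * a)%:E.
Proof.
move=> lf e0 hm hM.
pose P (K a : R) := forall x, (`|x - x0| <= r)%R ->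
  (m - e)%:E <= f x + (K * `|x - (xb + a *: u)| - l * a)%:E.
have cst : compact (`[s, t] : set R) := @segment_compact R s t.
have nearP : \forall K \near +oo%R, `[s, t] `<=` P K.
  apply: ((compact_near_coveringP _).1 cst) => a /=; rewrite in_itv/= => ast.
  have [|V /nbhs_ballP[d /= d0 hd] hV] := lf (xb + a *: u)%R (m + l * a - e / 2)%R.
    by apply: lt_le_trans (hm a ast); rewrite lte_fin; lra.
  (* At distance at least [d / 2], a factor [K > C] gives a penalty of at least
     [|m| + |M| + |l| (|a| + 1)], which dominates [m - M + l b] when [|a - b| < 1]. *)
  pose C := (2 * (`|m| + `|M| + `|l| * (`|a| + 1)) / d)%R.
  exists ([set b | `|a - b| < 1 /\ (`|l * a - l * b| < e / 2 /\
              `|(xb + a *: u) - (xb + b *: u)| < d / 2)]%R,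
          [set K | (Num.max C 0 < K)%R]) => /=.
    split; last by exists (Num.max C 0)%R; split => //; exact: num_real.
    apply: filterI.
      by have /cvgrPdist_lt/(_ _ ltr01) : id @ a --> a by exact: cvg_id.
    apply: filterI.
      have e20 : (0 < e / 2)%R by rewrite divr_gt0.
      have /cvgrPdist_lt/(_ _ e20) : (fun b => l * b)%R @ a --> (l * a)%R.
        by apply: cvgMr; exact: cvg_id.
      exact.
    have d20 : (0 < d / 2)%R by rewrite divr_gt0.
    have /cvgrPdist_lt/(_ _ d20) := @line_continuous _ _ xb u a.
    exact.
  move=> [b K] /= [[ab [lab xab]] KC] x xr.
  move: KC; rewrite gt_max => /andP[CK K0].
  have K0' : (0 <= K * `|x - (xb + b *: u)|)%R by rewrite mulr_ge0// ltW.
  have [xnear|xfar] := ltP `|x - (xb + b *: u)|%R (d / 2)%R.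
    have Vx : V x.
      apply: hd; rewrite -ball_normE/=.
      have : (`|xb + a *: u - x| <=
          `|xb + a *: u - (xb + b *: u)| + `|xb + b *: u - x|)%R.
        by rewrite (le_trans _ (ler_normD _ _))// addrA subrK.
      move: xnear; rewrite (distrC x); lra.
    apply: lee_addr_gt (hV _ Vx) _.
    by move: lab; rewrite ltr_norml; lra.
  apply: lee_addr_gt (hM _ xr) _.
  have H1 : (2 * (`|m| + `|M| + `|l| * (`|a| + 1)) <= K * d)%R.
    by move: CK; rewrite ltr_pdivrMr// => /ltW.
  have H2 : (K * (d / 2) <= K * `|x - (xb + b *: u)|)%R by rewrite ler_wpM2l// ltW.
  have H3 : (`|l * b| <= `|l| * (`|a| + 1))%R.
    rewrite normrM ler_wpM2l//.
    have : (`|b| <= `|a| + `|a - b|)%R.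
      by rewrite -[X in (`|X| <= _)%R](subKr a) ler_normB.
    move: ab; lra.
  have := ler_norm m; have := ler_norm (- M)%R; have := ler_norm (l * b)%R.
  rewrite normrN; lra.
have [K0 [_ hK0]] := nearP; exists (Num.max K0 0 + 1)%R.
  by rewrite addr_ge0// le_max lexx orbT.
move=> x a xr ast; apply: (hK0 (Num.max K0 0 + 1)%R) => //=.
by rewrite ltr_pwDr// le_max lexx.
Qed.

(** * Approximate mean value inequality *)

Section mean_value.
Context {R : realType} {X : completeNormedModType R}.
Context (df : (X -> \bar R) -> X -> set (dual X)) (sdf : subdifferential df).

(** A minimizer [x0] of [f] minus the slope [l] along the segment almost minimizes [f + phi] on a
    ball, with [phi] the segment penalty. The separation result then gives a limiting subgradient
    [p]: testing it along [u] bounds [p u], testing it towards the segment gives the second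
    estimate, and both pass to a nearby true subgradient. *)
Lemma approx_mean_value (f : X -> \bar R) (xb u : X) (s t l e : R) :
  ext_valued f -> lower_semicontinuous f -> u != 0%R -> (s < t)%R ->
  f (xb + s *: u)%R \is a fin_num ->
  f (xb + s *: u)%R + (l * (t - s))%:E < f (xb + t *: u)%R -> (0 < e)%R ->
  exists a x q, [/\ (s <= a < t)%R, df f x q, (`|x - (xb + a *: u)| < e)%R,
    (l - e < q u)%R & (- e < q (xb + a *: u - x))%R].
Proof.
move=> vf lf u0 st fs fst e0.
have nu0 : (0 < `|u|)%R by rewrite normr_gt0.
pose L a := (xb + a *: u)%R.
have cL : continuous L by exact: line_continuous.
have LB a b : (L a - L b)%R = ((a - b) *: u)%R.
  by rewrite /L opprD addrACA subrr add0r scalerBl.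
pose h a := f (L a) + (- (l * a))%:E.
have lh : lower_semicontinuous h.
  apply: (@lscD _ _ (f \o L)); first exact: lsc_comp.
  by move=> a; apply: cvgN; apply: cvgMr; exact: cvg_id.
have st0 : (`[s, t] : set R) !=set0 by exists s; rewrite /= in_itv/= lexx ltW.
have [a0 /=] := lsc_min lh (@segment_compact R s t) st0.
rewrite in_itv/= => /andP[sa0 a0t] hmin.
have {}hmin a : (s <= a <= t)%R -> h a0 <= h a.
  by move=> ast; apply: hmin; rewrite /= in_itv.
have hs : h s \is a fin_num by rewrite fin_numD fs.
have ffx0 : f (L a0) \is a fin_num.
  rewrite fin_numE vf/=; apply/eqP => fy; have := hmin s.
  by rewrite lexx ltW// => /(_ isT); rewrite -(fineK hs) [leLHS]/h fy addye// leye_eq.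
pose x0 := L a0; pose F := fine (f x0).
have fE : f x0 = F%:E by rewrite fineK.
pose m := (F - l * a0)%R.
have hm a : (s <= a <= t)%R -> (m + l * a)%:E <= f (L a).
  move=> /hmin; rewrite /h -/x0 fE -EFinD -leeBlDr// -EFinB.
  by rewrite opprK.
(* The increment of [f] exceeds [l (t - s)], so the value of [h] at [t] is larger than at [s]. *)
have {a0t} a0t : (a0 < t)%R.
  rewrite lt_neqAle a0t andbT; apply/eqP => a0E.
  have := hmin s; rewrite lexx ltW// => /(_ isT); apply/negP.
  rewrite -ltNge /h a0E -(fineK fs) -EFinD.
  rewrite -lteBlDr// -EFinB; apply: le_lt_trans fst.
  by rewrite -(fineK fs) -EFinD lee_fin; lra.
have [|V /nbhs_ballP[r' /= r'0 hr] hV] := lf x0 (F - 1)%R.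
  by rewrite fE lte_fin; lra.
pose r := (r' / 2)%R.
have r0 : (0 < r)%R by rewrite divr_gt0.
have hM x : (`|x - x0| <= r)%R -> (F - 1)%:E < f x.
  move=> xr; apply: hV; apply: hr; rewrite -ball_normE/= distrC.
  by apply: le_lt_trans xr _; rewrite /r; lra.
(* The three bounds keep the Ekeland point inside the ball, within the precision [e], and with
   parameter [a1 < t], since [L a1] is at distance at most [2 * d] from [L a0]. *)
pose d := (Num.min (r / 2) (Num.min (e / 4) ((t - a0) * `|u| / 4)))%R.
have tu0 : (0 < (t - a0) * `|u|)%R by rewrite mulr_gt0 ?subr_gt0.
have d0 : (0 < d)%R by rewrite !lt_min !divr_gt0.
have dr : (d <= r / 2)%R by rewrite /d ge_min lexx.
have de : (d <= e / 4)%R by rewrite /d !ge_min lexx orbT.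
have dt : (d <= (t - a0) * `|u| / 4)%R by rewrite /d !ge_min lexx !orbT.
(* This is the Ekeland slope; its effect in the direction [u] is at most [e / 2]. The tolerance in
   the choice of [K0] below is [c * d], as Ekeland's principle requires. *)
pose c := (e / (2 * (`|u| + 1)))%R.
have c0 : (0 < c)%R by rewrite divr_gt0// mulr_gt0// ltr_wpDl.
have cu : (c * `|u| <= e / 2)%R.
  have cE : (c * (`|u| + 1) = e / 2)%R by rewrite /c; field; lra.
  by move: c0 cE; lra.
have [K0 K00 hK0] := penalized_segment_min lf (mulr_gt0 c0 d0) hm hM.
(* The surplus [c] over [K0] forces [x1] to lie within [d] of [L a1], and [K >= c] absorbs the
   Ekeland slope in the direction [L a1 - x1]. *)
pose K := (K0 + c)%R.
have K_ge0 : (0 <= K)%R by rewrite addr_ge0// ltW.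
have [phi [cphi phile phiE]] := segment_penalty xb u l (ltW st) K_ge0.
have phix0 : (phi x0 <= - (l * a0))%R.
  have := phile x0 a0; rewrite sa0 ltW// => /(_ isT).
  by rewrite /x0 /L subrr normr0 mulr0 sub0r.
have drr : (d < r)%R by lra.
have [|x1 [p [x1d fx1 hp hpv]]] :=
    separation_ekeland sdf vf lf cphi ffx0 c0 r0 drr.
  move=> x xr; have [a ast phiEx] := phiE x.
  have H := hK0 x a xr ast; rewrite phiEx -/x0 fE -leeBlDr// -!EFinD.
  apply: (@le_trans _ _ (m - c * d)%:E); first by rewrite lee_fin /m; lra.
  apply: le_trans H _; rewrite leeD2l// lee_fin lerD2r ler_wpM2r//.
  by rewrite /K; lra.
have [a1 a1st phiE1] := phiE x1.
have x1r : (`|x1 - x0| <= r)%R by lra.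
have ffx1 : f x1 \is a fin_num.
  rewrite fin_numE vf/=; apply/eqP => fy; move: fx1.
  by rewrite fy addye// -/x0 fE leye_eq.
have x1a1 : (`|x1 - L a1| <= d)%R.
  rewrite -(ler_pM2l c0); have := hK0 x1 a1 x1r a1st; move: fx1.
  rewrite phiE1 -/x0 fE -(fineK ffx1) -!EFinD !lee_fin.
  have := phix0; rewrite /m /K -/(L a1); lra.
have a1t : (a1 < t)%R.
  have : (`|(a1 - a0) *: u| <= 2 * d)%R.
    rewrite -LB.
    have : (`|L a1 - L a0| <= `|L a1 - x1| + `|x1 - x0|)%R.
      by rewrite (le_trans _ (ler_normD _ _))// addrA subrK.
    rewrite (distrC _ x1); lra.
  rewrite normrZ => H.
  have : (`|a1 - a0| * `|u| < (t - a0) * `|u|)%R by lra.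
  rewrite ltr_pM2r// ltr_norml; lra.
(* Translating [x1] by [(t - a1) u] keeps its distance to the matching point of the segment, so
   [phi] drops by at least [l (t - a1)]. *)
have pu : (l - e / 2 <= p u)%R.
  have ta0 : (0 < t - a1)%R by rewrite subr_gt0.
  have := hpv ((t - a1) *: u)%R; rewrite dualZ normrZ gtr0_norm//.
  have := phile (x1 + (t - a1) *: u)%R t; rewrite lexx ltW// => /(_ isT).
  have -> : (x1 + (t - a1) *: u - (xb + t *: u) = x1 - (xb + a1 *: u))%R.
    rewrite scalerBl -addrA; congr (_ + _)%R.
    by rewrite !opprD [(- xb - t *: u)%R]addrC addrACA subrr add0r addrC.
  rewrite phiE1 => H1 H2; rewrite -(ler_pM2l ta0).
  have := ler_wpM2l (ltW ta0) cu; lra.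
have py : (0 <= p (L a1 - x1))%R.
  have := hpv (L a1 - x1)%R; rewrite (addrC x1) subrK (distrC (L a1)).
  have := phile (L a1) a1 a1st; rewrite /L subrr normr0 mulr0 sub0r phiE1 -/(L a1).
  have : (c * `|x1 - L a1| <= K * `|x1 - L a1|)%R by rewrite ler_wpM2r// /K; lra.
  lra.
have e40 : (0 < e / 4)%R by rewrite divr_gt0.
have [y [q [dy [yx1 _] qu qy qx]]] :=
  limiting_subdiff_approx u (L a1 - x1)%R hp ffx1 e40.
exists a1, y, q; split => //.
- by rewrite a1t (andP a1st).1.
- have : (`|y - L a1| <= `|y - x1| + `|x1 - L a1|)%R.
    by rewrite (le_trans _ (ler_normD _ _))// addrA subrK.
  rewrite -/(L a1); lra.
- move: qu; rewrite ltr_norml; lra.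
(* Here [q] varies together with [y], so [q (y - x1)] is controlled by the limsup condition on the
   net and not by weak-star convergence. *)
- have -> : (L a1 - y = (L a1 - x1) - (y - x1))%R by rewrite opprB addrA subrK.
  rewrite dualB; move: qy; rewrite ltr_norml; lra.
Qed.

End mean_value.

(** * Directional limits and Clarke subgradients *)

Section directional.
Context {R : realType} {X : normedModType R}.
Implicit Types (f g : X -> \bar R) (x u : X).

Lemma le_diff_quot f x u (t l : R) : (0 < t)%R -> f x \is a fin_num ->
  (l%:E <= diff_quot f x u t) = (f x + (l * t)%:E <= f (x + t *: u)%R).
Proof.
by move=> t0 fx; rewrite diff_quotE// lee_pdivlMr// leeBrDr// addeC EFinM.
Qed.

Lemma lt_diff_quot f x u (t l : R) : (0 < t)%R -> f x \is a fin_num ->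
  (l%:E < diff_quot f x u t) = (f x + (l * t)%:E < f (x + t *: u)%R).
Proof.
by move=> t0 fx; rewrite diff_quotE// lte_pdivlMr// lteBrDr// addeC EFinM.
Qed.

(** Taking [e = 1/(n+1)] yields points whose rescaled displacements [(z n - x) / t n] converge to
    [v], because the error is small relative to [t n]. *)
Lemma dir_limsup_ge (D : set X) (F : X -> \bar R) (x v : X) (l : \bar R) :
  (forall e : R, (0 < e)%R -> exists z (t : R),
     [/\ D z, (0 < t < e)%R, (`|z - (x + t *: v)| <= e * t)%R & l <= F z]) ->
  l <= dir_limsup D F x v.
Proof.
move=> H.
have H' n : exists zt : X * R, [/\ D zt.1, (0 < zt.2 < n.+1%:R^-1)%R,
    (`|zt.1 - (x + zt.2 *: v)| <= n.+1%:R^-1 * zt.2)%R & l <= F zt.1].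
  have n0 : (0 < n.+1%:R^-1 :> R)%R by [].
  by have [z [t h]] := H _ n0; exists (z, t).
have [zt {}H'] := choice H'.
pose z n := (zt n).1; pose t n := (zt n).2.
have t0 n : (0 < t n)%R by have [_ /andP[? _] _ _] := H' n.
have ct : t @ \oo --> (0 : R)%R.
  apply/cvgrPdist_lt => r r0.
  have /cvgrPdist_lt/(_ _ r0) := @cvg_harmonic R; apply: filterS => n.
  rewrite !sub0r !normrN (gtr0_norm (t0 n)) (gtr0_norm (harmonic_gt0 n)).
  by apply: lt_trans; have [_ /andP[_ ?] _ _] := H' n.
have cw : (fun n => (t n)^-1 *: (z n - x))%R @ \oo --> v.
  apply/cvgrPdist_lt => r r0.
  have /cvgrPdist_lt/(_ _ r0) := @cvg_harmonic R; apply: filterS => n.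
  rewrite sub0r normrN (gtr0_norm (harmonic_gt0 n)); apply: le_lt_trans.
  have [_ _ + _] := H' n; rewrite -/(z n) -/(t n) => zn.
  rewrite -(ler_pM2l (t0 n)) -[X in (X * _ <= _)%R](gtr0_norm (t0 n)) -normrZ.
  rewrite scalerBr scalerA divff ?gt_eqF// scale1r.
  by rewrite [leRHS]mulrC distrC; move: zn; rewrite opprD addrA.
apply: (@le_trans _ _ (limn_esup (F \o z))).
  apply: limf_esup_ge => A [N _ NA]; exists N; first by apply: NA => /=.
  by have [_ _ _ lF] := H' N.
apply: ereal_sup_ubound; exists z => //.
split; last by move=> n; have [Dn _ _ _] := H' n.
exists t, (fun n => (t n)^-1 *: (z n - x))%R; split=> //.
by move=> n; rewrite scalerA divff ?gt_eqF// scale1r addrC subrK.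
Qed.

(** The Clarke inequality gives a point [y] near [x] and a small step with quotient above some
    [l' > l]. Minimizing [g] minus the slope [l'] along this step gives [z] with lower subderivative
    at least [l'] in the direction [u']. At [z] the required direction is a positive multiple of
    [u'] with factor close to 1. *)
Lemma C_subdiff_lower_subderiv g x q (xb u : X) (a l e : R) :
  ext_valued g -> lower_semicontinuous g -> C_subdiff g x q -> (0 <= a)%R ->
  (l < q (u + a *: (xb - x))%R)%R -> (0 < e)%R ->
  exists z, [/\ edom g z, (`|z - x| < e)%R
    & l%:E <= lower_subderiv g z (u + a *: (xb - z))%R].
Proof.
move=> vg lg [gx hq] a0 lq e0.
set w := (u + a *: (xb - x))%R in lq *.
have gxfin : g x \is a fin_num by rewrite fin_numE vg -ltey.
pose l' := ((l + q w) / 2)%R.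
have ll' : (l < l')%R by rewrite /l'; lra.
have : l'%:E < circa_subderiv g x w.
  by apply: lt_le_trans (hq w); rewrite lte_fin /l'; lra.
move=> /ereal_sup_gt[_ [d /= d0 <-] hd].
pose e1 := (Num.min (e / 2) (d / (a + 1)))%R.
have a10 : (0 < a + 1)%R by rewrite ltr_wpDl.
have e10 : (0 < e1)%R by rewrite lt_min !divr_gt0.
(* For a step below [e2], the factor [c = 1 - a s0] is positive, [l' * c >= l], and the displacement
   from [y] to [z] is less than [e / 2]. *)
pose e2 := (Num.min (a + 1)^-1
  (Num.min ((l' - l) / ((a + 1) * (`|l'| + 1))) (e / (2 * (`|w| + d)))))%R.
have wd0 : (0 < `|w| + d)%R by rewrite ltr_wpDl.
have l10 : (0 < `|l'| + 1)%R by rewrite ltr_wpDl.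
have e20 : (0 < e2)%R.
  by rewrite !lt_min invr_gt0 a10 !divr_gt0// ?subr_gt0// mulr_gt0.
have [] := @limf_esup_gtP _ _ _ _ _ _
  [set ty : R * X | (0 < ty.1 < e2)%R /\
    ((`|x - ty.2| < e1)%R /\ g ty.2 \is a fin_num)] hd.
  exists ([set t | (0 < t < e2)%R],
          [set y | (`|x - y| < e1)%R /\ g y \is a fin_num]) => //=.
  split.
    by near=> t; rewrite /=; apply/andP; split.
  exists [set yz : X * \bar R | (`|x - yz.1| < e1)%R /\ yz.2 \is a fin_num] => //=.
  exists (ball x e1,
          [set z | z \is a fin_num /\ (`|fine z - fine (g x)| < 1)%R]) => /=.
    by split; [exact: nbhsx_ballx|exact: nbhs_fin_num_dist].
  by move=> [y z] /= [xy [zf _]]; split=> //; move: xy; rewrite -ball_normE.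
move=> [t y] [/= /andP[t0 te2] [xy gy]] hty.
(* The direction may depend on [y], since the quotient exceeds [l'] for all directions in the ball
   around [w]; the bound [d / (a + 1)] in [e1] puts [u'] there. *)
pose u' := (u + a *: (xb - y))%R.
have u'w : (`|w - u'| < d)%R.
  rewrite /w /u' opprD addrACA subrr add0r -scalerBr.
  rewrite opprB addrCA (addrAC xb) subrr add0r.
  rewrite normrZ ger0_norm// distrC.
  have : (e1 <= d / (a + 1))%R by rewrite /e1 ge_min lexx orbT.
  rewrite ler_pdivlMr//; have := normr_ge0 (x - y)%R; nra.
have u'n : (`|u'| < `|w| + d)%R.
  have : (`|u'| <= `|w| + `|w - u'|)%R.
    by rewrite -[X in (`|X| <= _)%R](subKr w) ler_normB.
  lra.
have hu' : l'%:E < diff_quot g y u' t.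
  apply: lt_le_trans hty _; apply: ereal_inf_lbound; exists u' => //.
  by rewrite -ball_normE.
rewrite lt_diff_quot// in hu'.
pose h s := g (y + s *: u')%R + (- (l' * s))%:E.
have lh : lower_semicontinuous h.
  apply: (@lscD _ _ (g \o (fun s => y + s *: u')%R)).
    by apply: lsc_comp => //; exact: line_continuous.
  by move=> s; apply: cvgN; apply: cvgMr; exact: cvg_id.
have st0 : (`[0%R, t] : set R) !=set0 by exists 0%R; rewrite /= in_itv/= lexx ltW.
have [s0 /=] := lsc_min lh (@segment_compact R 0%R t) st0.
rewrite in_itv/= => /andP[s00 s0t] hmin.
have {}hmin s : (0 <= s <= t)%R -> h s0 <= h s.
  by move=> st; apply: hmin; rewrite /= in_itv.
have h0 : h 0%R = g y by rewrite /h scale0r addr0 mulr0 oppr0 adde0.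
have hs0 : h s0 <= g y by rewrite -h0; apply: hmin; rewrite lexx ltW.
pose z := (y + s0 *: u')%R.
have gz : g z \is a fin_num.
  rewrite fin_numE vg/=; apply/eqP => gz; move: hs0.
  by rewrite /h -/z gz addye// leye_eq -(fineK gy).
have {}s0t : (s0 < t)%R.
  rewrite lt_neqAle s0t andbT; apply/eqP => s0E; move: hs0; apply/negP.
  rewrite -ltNge /h s0E; move: hu'; rewrite -(fineK gy) -EFinD.
  by rewrite EFinN lteBrDr// -EFinD.
have ate : (t * (a + 1) < 1)%R.
  have : (t < (a + 1)^-1)%R by apply: lt_le_trans te2 _; rewrite /e2 ge_min lexx.
  by rewrite -[X in (t < X)%R]div1r ltr_pdivlMr.
have tl : (t * ((a + 1) * (`|l'| + 1)) < l' - l)%R.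
  have : (t < (l' - l) / ((a + 1) * (`|l'| + 1)))%R.
    by apply: lt_le_trans te2 _; rewrite /e2 !ge_min lexx !orbT.
  by rewrite ltr_pdivlMr// mulr_gt0.
have tw : (t * (2 * (`|w| + d)) < e)%R.
  have : (t < e / (2 * (`|w| + d)))%R.
    by apply: lt_le_trans te2 _; rewrite /e2 !ge_min lexx !orbT.
  by rewrite ltr_pdivlMr// mulr_gt0.
pose c := (1 - a * s0)%R.
have c0 : (0 < c)%R by rewrite /c; nra.
have zE : (u + a *: (xb - z) = c *: u')%R.
  by rewrite /z /c scalerBl scale1r -scalerA opprD addrA scalerBr addrA.
exists z; split.
- by rewrite /edom/= ltey_eq gz.
- have : (`|z - x| <= `|x - y| + s0 * `|u'|)%R.
    rewrite /z addrAC (le_trans (ler_normD _ _))// normrZ ger0_norm//.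
    by rewrite distrC.
  have : (e1 <= e / 2)%R by rewrite /e1 ge_min lexx.
  have : (s0 * `|u'| <= t * (`|w| + d))%R by rewrite ler_pM// ltW.
  lra.
rewrite zE; apply: (@limf_einf_ge _ _ _ _ _ [set s : R | (0 < s < (t - s0) / c)%R]).
  near=> s; rewrite /=; apply/andP; split => //; near: s; apply: nbhs_right_lt.
  by rewrite divr_gt0// subr_gt0.
move=> s /= /andP[sp]; rewrite ltr_pdivlMr// => sc.
rewrite le_diff_quot//.
have -> : (z + s *: (c *: u') = y + (s0 + s * c) *: u')%R.
  by rewrite /z scalerA scalerDl addrA.
have : h s0 <= h (s0 + s * c)%R.
  have sc0 : (0 < s * c)%R by rewrite mulr_gt0.
  by apply: hmin; apply/andP; split; lra.
rewrite /h -/z -(fineK gz) -!EFinD -leeBlDr// => H; apply: le_trans H.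
rewrite -EFinB lee_fin.
have : (l <= l' * c)%R.
  have as0 : (a * s0 * l' <= a * s0 * (`|l'| + 1))%R.
    by rewrite ler_wpM2l ?mulr_ge0//; have := ler_norm l'; lra.
  have : (a * s0 * (`|l'| + 1) <= t * (a + 1) * (`|l'| + 1))%R.
    by rewrite ler_wpM2r ?(ltW l10)//; nra.
  by move: tl; rewrite mulrA /c; lra.
move=> /(ler_wpM2l (ltW sp)); lra.
Unshelve. all: by end_near. Qed.

End directional.

(** * Comparison of the subderivatives of [f] and [g] *)

Section comparison.
Context {R : realType} {X : completeNormedModType R}.
Context (df : (X -> \bar R) -> X -> set (dual X)) (sdf : subdifferential df).
Context (Omega : set X) (f g : X -> \bar R).
Hypotheses (oO : open Omega) (pf : proper_fun f) (lf : lower_semicontinuous f).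
Hypotheses (pg : proper_fun g) (lg : lower_semicontinuous g).
Hypothesis (dfg : forall x, (Omega `&` edom f) x -> df f x `<=` df g x).

(** If the inequality failed, semismoothness would provide [a] with directional limsup below some
    [l0 < f^r_+]. The mean value inequality for [f], the inclusion of subdifferentials and the
    Clarke estimate for [g] produce points converging in the direction [u] where that lower
    subderivative is at least [l0]. *)
Lemma upper_le_lower_subderiv (y u : X) : Omega y -> u != 0%R ->
  f y \is a fin_num ->
  (forall e : R, (0 < e)%R -> \forall s \near (0 : R)^'+,
     f (y + s *: u)%R \is a fin_num /\
     (`|fine (f (y + s *: u)%R) - fine (f y)| < e)%R) ->
  upper_semismooth g y u ->
  upper_subderiv f y u <= lower_subderiv g y u.
Proof.
move=> Oy u0 fy cf sg; rewrite leNgt; apply/negP => /ereal_between[l0 gl0 l0f].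
have [l1 l01 l1f] := ereal_between l0f; rewrite lte_fin in l01.
have /ereal_inf_lt[_ [a /= a0 <-]] := le_lt_trans sg gl0.
apply/negP; rewrite -leNgt; apply: dir_limsup_ge => e e0.
have /nbhs_ballP[r /= r0 hr] : nbhs y Omega by exact: open_nbhs_nbhs.
have nu0 : (0 < `|u|)%R by rewrite normr_gt0.
have a10 : (0 < a + 1)%R by rewrite ltr_wpDl.
have l10 : (0 < `|l1| + 1)%R by rewrite ltr_wpDl.
have d0 : (0 < l1 - l0)%R by rewrite subr_gt0.
have near_t : \forall t \near (0 : R)^'+, [/\ (0 < t)%R, (t < e)%R,
    (t * (2 * `|u|) < r)%R, (t * (a + 1) < 1)%R
    & (t * (4 * ((a + 1) * (`|l1| + 1))) < l1 - l0)%R].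
  near=> t; split => //.
  - rewrite -ltr_pdivlMr ?mulr_gt0//; near: t; apply: nbhs_right_lt.
    by rewrite divr_gt0// mulr_gt0.
  - by rewrite -ltr_pdivlMr//; near: t; apply: nbhs_right_lt; rewrite divr_gt0.
  - rewrite -ltr_pdivlMr ?mulr_gt0//; near: t; apply: nbhs_right_lt.
    by rewrite divr_gt0// !mulr_gt0.
have [t [[t0 te tr ta tl] [ft _]]] :=
  limf_esup_gtP l1f (filterI near_t (cf 1%R ltr01)).
rewrite lt_diff_quot// -(fineK fy) -(fineK ft) -EFinD lte_fin => ft1.
pose G := (fine (f (y + t *: u)%R) - fine (f y) - l1 * t)%R.
have G0 : (0 < G)%R by rewrite /G; lra.
have G20 : (0 < G / 2)%R by rewrite divr_gt0.
(* Continuity along the ray moves the lower endpoint from 0 to some [s > 0] while keeping a mean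
   slope above [l1]. Errors can then be made small relative to [s], hence to the parameter [b >= s],
   as directional convergence demands. *)
have [s [s0 st sG fs sf]] : exists s, [/\ (0 < s)%R, (s < t)%R,
    (s * (`|l1| + 1) < G / 2)%R, f (y + s *: u)%R \is a fin_num
    & (`|fine (f (y + s *: u)%R) - fine (f y)| < G / 2)%R].
  near (0 : R)^'+ => s; exists s.
  have [] : f (y + s *: u)%R \is a fin_num /\
     (`|fine (f (y + s *: u)%R) - fine (f y)| < G / 2)%R.
    by near: s; exact: cf.
  split=> //.
  rewrite -ltr_pdivlMr//; near: s; apply: nbhs_right_lt.
  by rewrite divr_gt0.
(* The first bound is spent twice, on [x] and on [z], for a total of [e * s <= e * b]; the second
   keeps [x] in [Omega]; the third limits the loss between [l1] and [l0]. *)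
pose e1 := (Num.min (e * s / 2) (Num.min (r / 4) ((l1 - l0) / (4 * (a + 1)))))%R.
have e10 : (0 < e1)%R by rewrite !lt_min !divr_gt0 ?mulr_gt0.
have e1s : (e1 <= e * s / 2)%R by rewrite /e1 ge_min lexx.
have e1r : (e1 <= r / 4)%R by rewrite /e1 !ge_min lexx orbT.
have e1a : (e1 * (4 * (a + 1)) <= l1 - l0)%R.
  by rewrite -ler_pdivlMr ?mulr_gt0// /e1 !ge_min lexx !orbT.
have fst : f (y + s *: u)%R + (l1 * (t - s))%:E < f (y + t *: u)%R.
  rewrite -(fineK fs) -(fineK ft) -EFinD lte_fin.
  have : (- (l1 * s) <= s * (`|l1| + 1))%R.
    have := ler_norm (- l1)%R; rewrite normrN => /(ler_wpM2l (ltW s0)); lra.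
  move: sf sG; rewrite /G ltr_norml; lra.
have [b [x [q [/andP[sb bt] dq xb qu qx]]]] :=
  approx_mean_value sdf pf.1 lf u0 st fs fst e10.
have Ox : Omega x.
  apply: hr; rewrite -ball_normE/= distrC.
  have : (`|x - y| <= `|x - (y + b *: u)| + `|b *: u|)%R.
    have -> : (x - y = x - (y + b *: u) + b *: u)%R by rewrite opprD addrA subrK.
    exact: ler_normD.
  rewrite normrZ gtr0_norm; last lra.
  have : (b * `|u| <= t * `|u|)%R by rewrite ler_wpM2r// ltW.
  by move: tr; lra.
have [fx _] := (sdf.1 _ pf lf x).2 q dq.
have gq := (sdf.1 _ pg lg x).2 q (dfg (conj Ox fx) dq).
have b0 : (0 < b)%R by lra.
(* The direction splits into [(1 - a b) u] and [a (y + b u - x)], the two vectors on which the mean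
   value inequality bounds [q] from below. *)
have lq : (l0 < q (u + a *: (y - x))%R)%R.
  have -> : (u + a *: (y - x) = (1 - a * b) *: u + a *: (y + b *: u - x))%R.
    rewrite scalerBl scale1r -addrA; congr (_ + _)%R.
    rewrite -scalerA -scalerN -scalerDr; congr (_ *: _)%R.
    by rewrite addrA (addrCA _ y) addNr addr0.
  rewrite dualD !dualZ.
  have ab : (0 <= a * b)%R by rewrite mulr_ge0// ltW.
  have ab1 : (a * b <= t * (a + 1))%R by nra.
  have abl : (a * b * l1 <= t * (a + 1) * (`|l1| + 1))%R.
    apply: (@le_trans _ _ (a * b * (`|l1| + 1))%R).
      by rewrite ler_wpM2l//; have := ler_norm l1; lra.
    by rewrite ler_wpM2r// ltW.
  have c0 : (0 <= 1 - a * b)%R by lra.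
  have := ler_wpM2l c0 (ltW qu); have := ler_wpM2l a0 (ltW qx).
  have := mulr_ge0 ab (ltW e10).
  move: abl tl e1a e10; lra.
have [z [gz zx lz]] := C_subdiff_lower_subderiv pg.1 lg gq a0 lq e10.
exists z, b; split => //; first by rewrite b0 (lt_trans bt).
have : (`|z - (y + b *: u)| <= `|z - x| + `|x - (y + b *: u)|)%R.
  by rewrite (le_trans _ (ler_normD _ _))// addrA subrK.
have : (e * s <= e * b)%R by rewrite ler_wpM2l// ltW.
lra.
Unshelve. all: by end_near. Qed.

End comparison.

Lemma convex_set_line (R : realType) (X : normedModType R) (Omega : set X)
    (x u : X) (t : R) :
  convex_set (Omega : set (convex_lmodType X)) -> Omega x -> Omega (x + u)%R ->
  (0 <= t <= 1)%R -> Omega (x + t *: u)%R.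
Proof.
move=> cO Ox Oxu /andP[t0 t1].
have /set_mem := cO (x + u)%R x (Itv01 t0 t1) (mem_set Oxu) (mem_set Ox).
suff -> : (x + t *: u = t *: (x + u) + (1 - t) *: x)%R by [].
by rewrite scalerDr scalerBl scale1r [RHS]addrC addrA subrK.
Qed.

(** * Integration along a segment *)

Section integration.
Context {R : realType} {X : completeNormedModType R}.
Context (df : (X -> \bar R) -> X -> set (dual X)) (sdf : subdifferential df).
Context (Omega : set X) (f g : X -> \bar R).
Hypotheses (oO : open Omega) (pf : proper_fun f) (lf : lower_semicontinuous f).
Hypotheses (pg : proper_fun g) (lg : lower_semicontinuous g).
Hypothesis (dfg : forall x, (Omega `&` edom f) x -> df f x `<=` df g x).
Implicit Types x u : X.

(** A real number [v] between the two subderivatives lets the quotients of [f] and [g] be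
    subtracted. Finiteness of one of them provides [v]; equal infinite values would say nothing
    about the difference. *)
Lemma upper_dini_sub x u : u != 0%R ->
  f x \is a fin_num -> g x \is a fin_num ->
  (\forall s \near (0 : R)^'+,
     f (x + s *: u)%R \is a fin_num /\ g (x + s *: u)%R \is a fin_num) ->
  upper_subderiv f x u <= lower_subderiv g x u ->
  upper_subderiv f x u \is a fin_num \/ lower_subderiv g x u \is a fin_num ->
  forall e : R, (0 < e)%R -> \forall s \near (0 : R)^'+,
    (fine (f (x + s *: u)%R) - fine (g (x + s *: u)%R) - (fine (f x) - fine (g x))
      <= e * s)%R.
Proof.
move=> u0 fx gx fgs fg fin e e0.
have [v vf vg] : exists2 v : R, upper_subderiv f x u <= v%:E
                              & v%:E <= lower_subderiv g x u.
  case: fin => fin.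
    by exists (fine (upper_subderiv f x u)); rewrite fineK.
  by exists (fine (lower_subderiv g x u)); rewrite fineK.
have [A A0 hA] : exists2 A, (0 : R)^'+ A &
    forall s, A s -> diff_quot f x u s < (v + e / 2)%:E.
  by apply: limf_esup_ltP; apply: le_lt_trans vf _; rewrite lte_fin; lra.
have [B B0 hB] : exists2 B, (0 : R)^'+ B &
    forall s, B s -> (v - e / 2)%:E < diff_quot g x u s.
  by apply: limf_einf_gtP; apply: lt_le_trans vg; rewrite lte_fin; lra.
near=> s.
have s0 : (0 < s)%R by [].
have [fs gs] : f (x + s *: u)%R \is a fin_num /\ g (x + s *: u)%R \is a fin_num.
  by near: s.
have : diff_quot f x u s < (v + e / 2)%:E by apply: hA; near: s.
have : (v - e / 2)%:E < diff_quot g x u s by apply: hB; near: s.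
rewrite lt_diff_quot// [_ < (v + _)%:E]ltNge le_diff_quot// -ltNge.
rewrite -(fineK fs) -(fineK gs) -(fineK fx) -(fineK gx) -!EFinD !lte_fin /=.
lra.
Unshelve. all: by end_near. Qed.

Lemma sub_le_of_segment x u :
  convex_set (Omega : set (convex_lmodType X)) ->
  Omega x -> Omega (x + u)%R -> u != 0%R ->
  let xb := fun t : R => (x + t *: u)%R in
  (forall t, t \in `[0%R, 1%R] ->
     f (xb t) \is a fin_num /\ g (xb t) \is a fin_num) ->
  {within `[0%R, 1%R], continuous (f \o xb)} ->
  {within `[0%R, 1%R], continuous (g \o xb)} ->
  forall C : set R, countable C ->
  (forall t, t \in `[0%R, 1%R] -> ~ C t ->
     (upper_subderiv f (xb t) u \is a fin_num \/
      lower_subderiv g (xb t) u \is a fin_num) /\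
     upper_semismooth g (xb t) u) ->
  (fine (f (x + u)%R) - fine (g (x + u)%R) <= fine (f x) - fine (g x))%R.
Proof.
move=> cO Ox Oxu u0 xb fin cf cg C cC hC.
have cwithin (k : X -> \bar R) (t : R) :
    (forall t, t \in `[0%R, 1%R] -> k (xb t) \is a fin_num) ->
    {within `[0%R, 1%R], continuous (k \o xb)} -> (0 <= t <= 1)%R ->
    (fun s => fine (k (xb s))) @ within `[0%R, 1%R] (nbhs t) --> fine (k (xb t)).
  move=> kfin ck t01.
  have /(_ t) ckt := (subspace_continuousP _ _).1 ck.
  apply: fine_cvg; rewrite fineK; last by apply: kfin; rewrite in_itv.
  by apply: ckt; rewrite /= in_itv.
have ffin t : t \in `[0%R, 1%R] -> f (xb t) \is a fin_num by case/fin.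
have gfin t : t \in `[0%R, 1%R] -> g (xb t) \is a fin_num by case/fin.
have xbD t s : (xb t + s *: u = xb (t + s))%R by rewrite /xb scalerDl addrA.
have near01 (t : R) : (0 <= t < 1)%R ->
    \forall s \near (0 : R)^'+, (t + s)%R \in `[0%R, 1%R].
  move=> /andP[t0 t1]; near=> s.
  have s0 : (0 < s)%R by [].
  have st : (s < 1 - t)%R by near: s; apply: nbhs_right_lt; lra.
  by rewrite in_itv/=; apply/andP; split; lra.
have cfright (t e : R) : (0 <= t < 1)%R -> (0 < e)%R -> \forall s \near (0 : R)^'+,
    f (xb t + s *: u)%R \is a fin_num /\
    (`|fine (f (xb t + s *: u)%R) - fine (f (xb t))| < e)%R.
  move=> /[dup] t01 /andP[t0 t1] e0.
  have t01' : (0 <= t <= 1)%R by rewrite t0 ltW.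
  have /cvgrPdist_lt/(_ _ e0) := cwithin f t ffin cf t01'.
  rewrite near_withinE => /nbhs_ballP[d /= d0 hd].
  have n01 := near01 t t01.
  near=> s.
  have s0 : (0 < s)%R by [].
  have ts : (t + s)%R \in `[0%R, 1%R] by near: s.
  have sd : (s < d)%R by near: s; exact: nbhs_right_lt.
  rewrite xbD; split; first exact: ffin.
  rewrite distrC; apply: (hd (t + s)%R) => //.
  rewrite /ball/= opprD addrA subrr sub0r normrN gtr0_norm//.
have := @upper_dini_le0 R (fun t => fine (f (xb t)) - fine (g (xb t)))%R C.
rewrite /xb scale1r scale0r addr0; apply => //.
  apply/subspace_continuousP => t; rewrite /= in_itv/= => t01.
  by apply: cvgB; exact: cwithin.
move=> t /[dup] t01 /andP[t0 t1] Ct e e0.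
have t01' : t \in `[0%R, 1%R] by rewrite in_itv/= t0 ltW.
have [hfin hsm] := hC t t01' Ct.
have Oxt : Omega (xb t) by apply: convex_set_line => //; rewrite t0 ltW.
have ule : upper_subderiv f (xb t) u <= lower_subderiv g (xb t) u.
  apply: (upper_le_lower_subderiv sdf oO pf lf pg lg dfg) => //; first exact: ffin.
  by move=> d d0; exact: cfright.
have fin_near : \forall s \near (0 : R)^'+,
    f (xb t + s *: u)%R \is a fin_num /\ g (xb t + s *: u)%R \is a fin_num.
  by apply: filterS (near01 t t01) => s ts; rewrite xbD; exact: fin.
have H := upper_dini_sub u0 (ffin t t01') (gfin t t01') fin_near ule hfin e0.
by apply: filterS H => s; rewrite xbD.
Unshelve. all: by end_near. Qed.

End integration.

(** * Constancy of the difference on the whole domain *)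

Unset Implicit Arguments.

Theorem theorem10 (R : realType) (X : completeNormedModType R)
    (df : (X -> \bar R) -> X -> set (dual X)) (Omega : set X)
    (f g : X -> \bar R) :
  subdifferential df ->
  open Omega -> convex_set (Omega : set (convex_lmodType X)) ->
  Omega !=set0 ->
  proper_fun f -> lower_semicontinuous f ->
  proper_fun g -> lower_semicontinuous g ->
  Omega `&` edom f !=set0 ->
  (forall xbar u : X,
     (Omega `&` dom_subdiff (df f) `&` dom_subdiff (df g)) xbar ->
     u != 0%R ->
     (Omega `&` edom f `&` edom g) (xbar + u)%R ->
     let xb := fun t : R => (xbar + t *: u)%R in
     [/\ forall t, t \in `[0%R, 1%R] ->
           f (xb t) \is a fin_num /\ g (xb t) \is a fin_num,
         {within `[0%R, 1%R], continuous (f \o xb)},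
         {within `[0%R, 1%R], continuous (g \o xb)}
       & exists C : set R,
           [/\ C `<=` `[0%R, 1%R], countable C
             & forall t, t \in `[0%R, 1%R] -> ~ C t ->
                 (upper_subderiv f (xb t) u \is a fin_num \/
                  lower_subderiv g (xb t) u \is a fin_num) /\
                 upper_semismooth g (xb t) u]]) ->
  (forall x, (Omega `&` edom f) x -> df f x `<=` df g x) ->
  exists c : R, forall x, (Omega `&` edom f) x -> f x = g x + c%:E.
Proof.
move=> sdf oO cO _ pf lf pg lg [x0 [Ox0 fx0]] hseg dfg.
have vf := pf.1; have vg := pg.1.
have efin (k : X -> \bar R) x : ext_valued k -> edom k x -> k x \is a fin_num.
  by move=> vk kx; rewrite fin_numE vk -ltey.
have domf x : dom_subdiff (df f) x -> edom f x.
  by move=> [q /(sdf.1 _ pf lf x).2 []].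
have domg x : Omega x -> dom_subdiff (df f) x ->
    dom_subdiff (df g) x /\ edom g x.
  move=> Ox fx; have [q dq] := fx; have gq := dfg x (conj Ox (domf _ fx)) _ dq.
  by split; [exists q|have [] := (sdf.1 _ pg lg x).2 q gq].
have dense x (A : set X) (e : R) : (Omega `&` edom f) x -> nbhs x A ->
    (0 < e)%R -> exists y, [/\ Omega y, A y, dom_subdiff (df f) y
      & (fine (f y) < fine (f x) + e)%R].
  move=> [Ox fx] Ax e0.
  have /nbhs_ballP[r /= r0 hr] : nbhs x (Omega `&` A).
    by apply: filterI => //; exact: open_nbhs_nbhs.
  pose d := (Num.min r e)%R.
  have d0 : (0 < d)%R by rewrite lt_min r0.
  have [y [dy yx _ fyx]] := dom_subdiff_dense sdf vf lf (efin _ _ vf fx) d0.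
  have [Oy Ay] : (Omega `&` A) y.
    apply: hr; rewrite -ball_normE/= distrC; apply: lt_le_trans yx _.
    by rewrite /d ge_min lexx.
  exists y; split => //.
  have : (d <= e)%R by rewrite /d ge_min lexx orbT.
  move: fyx; rewrite ltr_norml; lra.
pose D x := (fine (f x) - fine (g x))%R.
(* Only the starting point has to carry a subgradient. Exchanging two points that both do gives
   equality, and a general endpoint is used at the end. *)
have mono x y : Omega x -> dom_subdiff (df f) x -> Omega y -> edom f y ->
    edom g y -> (D y <= D x)%R.
  move=> Ox dx Oy fy gy; have [dgx gx] := domg x Ox dx.
  have [->//|yx] := eqVneq y x.
  have yE : (x + (y - x) = y)%R by rewrite addrC subrK.
  have u0 : (y - x != 0)%R by rewrite subr_eq0.
  have := hseg x (y - x)%R; rewrite yE.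
  move=> /(_ (conj (conj Ox dx) dgx) u0 (conj (conj Oy fy) gy)).
  move=> [fin cf cg [C [_ cC hC]]].
  have := sub_le_of_segment sdf oO pf lf pg lg dfg cO Ox _ u0 fin cf cg cC hC.
  by rewrite yE; exact.
have [y0 [Oy0 _ dy0 _]] := dense x0 setT 1%R (conj Ox0 fx0) filterT ltr01.
have Dc x : Omega x -> dom_subdiff (df f) x -> D x = D y0.
  move=> Ox dx; have [_ gx] := domg x Ox dx; have [_ gy0] := domg y0 Oy0 dy0.
  by apply/eqP; rewrite eq_le !mono//; exact: domf.
exists (D y0) => y [Oy fy].
have fyfin := efin _ _ vf fy.
(* Otherwise [g] stays above some [b] near [y], whereas density gives a nearby point where [f - g]
   equals [D y0] and [f] is small enough to put [g] below [b]. This also shows that [y] is in the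
   domain of [g], so that [mono] from [y0] to [y] applies and gives the reverse inequality. *)
have gle : g y <= (fine (f y) - D y0)%:E.
  rewrite leNgt; apply/negP => /ereal_between[b ab bg].
  rewrite lte_fin in ab.
  have [V Vy hV] := lg _ _ bg.
  have e0 : (0 < b - (fine (f y) - D y0))%R by rewrite subr_gt0.
  have [x [Ox /hV gx dx fx]] := dense y V _ (conj Oy fy) Vy e0.
  have [_ gx'] := domg x Ox dx.
  move: gx; rewrite -(fineK (efin _ _ vg gx')) lte_fin.
  by have := Dc x Ox dx; move: fx; rewrite /D; lra.
have gy : edom g y by exact: le_lt_trans gle (ltry _).
have gyfin := efin _ _ vg gy.
have := mono y0 y Oy0 dy0 Oy fy gy.
move: gle; rewrite -(fineK gyfin) lee_fin => gle Dle.
rewrite -(fineK fyfin) -EFinD; congr EFin.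
by move: gle Dle; rewrite /D; lra.
Qed.
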